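(* Let $\{W_t\}_{t\in\mathbb{R}}$ be a standard Brownian motion on the real line and let the Gaussian field $\{W_H(t)\}_{t\in\mathbb{R},H\in(0,1)}$ be defined, for $H\neq\frac12$, by $$W_H(t)=\frac{1}{d_H}\int_{-\infty}^{\infty}\left(|t-x|^{H-\frac12}-|x|^{H-\frac12}\right)dW_x,$$ and, for $H=\frac12$, by $$W_{\frac12}(t)=\frac{1}{d_{\frac12}}\int_{-\infty}^{\infty}\left(\log\left(\frac{1}{|t-x|}\right)-\log\left(\frac{1}{|x|}\right)\right)dW_x,$$ all with respect to the same Brownian motion. Then for all $s,t\in\mathbb{R}$ and $H,H'\in(0,1)$, $$\mathbb{E}\,W_H(t)W_{H'}(s)=\frac{k_Hk_{H'}}{d_Hd_{H'}}\;\frac{d_{\frac{H+H'}{2}}^2}{k_{\frac{H+H'}{2}}^2}\left(\frac{|t|^{H+H'}+|s|^{H+H'}-|t-s|^{H+H'}}{2}\right).$$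
   Context: The stochastic integrals are Wiener integrals of deterministic $L^2(\mathbb{R})$ functions. For $H\in(0,1)\setminus\{\frac12\}$, $$d_H=\frac{\Gamma(H+\frac12)}{\sqrt{\Gamma(2H+1)}}\sqrt{2\left(\frac{1-\sin(\pi H)}{\sin(\pi H)}\right)},\qquad k_H=-2\,\Gamma\left(H+\tfrac12\right)\sin\left(\left(H-\tfrac12\right)\tfrac{\pi}{2}\right),$$ and $d_{\frac12}=\pi$, $k_{\frac12}=\pi$. *)

(* Defs.v *)
From HB Require Import structures.
From mathcomp Require Import all_boot all_order all_algebra.
From mathcomp Require Import all_classical all_reals all_analysis.

Set Implicit Arguments.
Unset Strict Implicit.
Unset Printing Implicit Defensive.

Import Order.TTheory GRing.Theory Num.Theory.
Import numFieldNormedType.Exports.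

Local Open Scope classical_set_scope.
Local Open Scope ring_scope.

(* The sets [A i] may be [setT], so the product rule over the whole family
   contains the product rules over all its subfamilies. *)
Definition mutually_independent (d : measure_display) (T : measurableType d)
    (R : realType) (P : probability T R) (n : nat) (X : 'I_n -> T -> R) :
    Prop :=
  forall A : 'I_n -> set R, (forall i, measurable (A i)) ->
    P (\bigcap_(i in [set: 'I_n]) (X i @^-1` A i))
    = (\prod_(i < n) P (X i @^-1` A i))%E.

Definition increment (d : measure_display) (T : measurableType d)
    (R : realType) (P : probability T R) (W : R -> {RV P >-> R}) (s t : R) :
    T -> R :=
  W t \- W s.

(* Standard two-sided Brownian motion. The second parameter of [normal_prob]
   is the standard deviation. *)
Record brownian_motion (d : measure_display) (T : measurableType d)
    (R : realType) (P : probability T R) (W : R -> {RV P >-> R}) : Prop := {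
  bm_start : {ae P, forall w, W 0 w = 0} ;
  bm_increment : forall s t : R, s < t ->
    forall A : set R, measurable A ->
      pushforward P (increment W s t) A = normal_prob 0 (Num.sqrt (t - s)) A ;
  bm_independent : forall (n : nat) (t : nat -> R),
    {homo t : i j / (i <= j)%N >-> i <= j} ->
    mutually_independent P (fun i : 'I_n => increment W (t i) (t i.+1)) ;
  bm_continuous : {ae P, forall w, continuous (fun t : R => W t w)}
}.

(* The list [p] of triples [((c, a), b)] encodes the step function
   [\sum c * 1_]a, b]]. *)
Definition step_ok (R : realType) (p : seq (R * R * R)) : bool :=
  all (fun u => u.1.2 <= u.2) p.

Definition step_fun (R : realType) (p : seq (R * R * R)) (x : R) : R :=
  \sum_(u <- p) u.1.1 * \1_(`]u.1.2, u.2]%classic : set R) x.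

Definition step_wiener (d : measure_display) (T : measurableType d)
    (R : realType) (P : probability T R) (W : R -> {RV P >-> R})
    (p : seq (R * R * R)) (w : T) : R :=
  \sum_(u <- p) u.1.1 * increment W u.1.2 u.2 w.

(* [I] is a version of the Wiener integral of [f]: the integral is the
   L^2-isometric extension of [step_wiener], hence is determined only up to
   almost sure equality. *)
Definition is_wiener_integral (d : measure_display) (T : measurableType d)
    (R : realType) (P : probability T R) (W : R -> {RV P >-> R})
    (f : R -> R) (I : {RV P >-> R}) : Prop :=
  [/\ f \in Lfun (@lebesgue_measure R) 2%:E,
      (I : T -> R) \in Lfun P 2%:E &
      exists p : nat -> seq (R * R * R),
      [/\ forall n, step_ok (p n),
          ('N[@lebesgue_measure R]_2%:E[EFin \o (f \- step_fun (p n))%R])%E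
            @[n --> \oo] --> 0%E &
          ('N[P]_2%:E[EFin \o ((I : T -> R) \- step_wiener W (p n))%R])%E
            @[n --> \oo] --> 0%E]].

Definition Gamma (R : realType) (s : R) : R :=
  \int[@lebesgue_measure R]_(x in `]0, +oo[) (x `^ (s - 1) * expR (- x)).

Definition dconst (R : realType) (H : R) : R :=
  if H == 2^-1 then pi
  else Gamma (H + 2^-1) / Num.sqrt (Gamma (2 * H + 1)) *
       Num.sqrt (2 * ((1 - sin (pi * H)) / sin (pi * H))).

Definition kconst (R : realType) (H : R) : R :=
  if H == 2^-1 then pi
  else - 2 * Gamma (H + 2^-1) * sin ((H - 2^-1) * (pi / 2)).

(* The library sets [ln 0 = 0] and [0 `^ a = 0] for [a != 0], which
   affects the kernel only on the null set [x = t] or [x = 0]. *)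
Definition fbm_kernel (R : realType) (H t x : R) : R :=
  if H == 2^-1 then ln (1 / `|t - x|) - ln (1 / `|x|)
  else `|t - x| `^ (H - 2^-1) - `|x| `^ (H - 2^-1).

Definition is_fbm_field (d : measure_display) (T : measurableType d)
    (R : realType) (P : probability T R) (W : R -> {RV P >-> R})
    (WH : R -> R -> {RV P >-> R}) : Prop :=
  forall H t : R, 0 < H < 1 ->
    exists2 I : {RV P >-> R}, is_wiener_integral W (fbm_kernel H t) I &
      forall w, WH H t w = 1 / dconst H * I w.

(* Main.v *)
Require Import Defs.
From HB Require Import structures.
From mathcomp Require Import all_boot all_order all_algebra.
From mathcomp Require Import ring lra.
From mathcomp Require Import all_classical all_reals all_analysis.
From mathcomp Require Import measurable_realfun.

Set Implicit Arguments.
Unset Strict Implicit.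
Unset Printing Implicit Defensive.

Import Order.TTheory GRing.Theory Num.Theory.
Import numFieldNormedType.Exports.

Local Open Scope classical_set_scope.
Local Open Scope ring_scope.

(** Both sides are computed: the left side by the Wiener isometry and an
    integral representation of the kernels, the right side by the reflection
    formula for the sine.

    Isometry ([wiener_isometry]).  The expectation of a product of two Wiener
    integrals is the integral of the product of the two functions.  For step
    functions this follows by polarization from the single fact that the
    increment of W from s to t has second moment |t - s|; the general case
    follows by continuity of the two inner products in L^2.  It remains to
    integrate over x the product of the kernels K_H(t, x) and K_H'(s, x).

    Kernels ([integral_dlayer], [fbm_kernelE]).  Put a = H - 1/2 and
    b = H' - 1/2.  With c(a) = -(2/pi) sin(pi a/2), and c(0) = 1 in the
    logarithmic case,
      K_H(t, x) = c(a) int_0^oo p^a (P_p(t - x) - P_p(x)) dp,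
    where P_p(x) = p/(p^2 + x^2) is pi times the Poisson kernel of the upper
    half plane.  The logarithm and the powers are thereby treated alike: for
    a < 0 this is the formula |A|^a = c(a) int p^a P_p(A) dp, for a > 0 it is
    its analytic continuation, and for a = 0 it is Frullani's integral.  The
    constant k_H of the statement is pi Gamma(a+1) c(a) ([kconstE]).

    Integration over x ([poisson_conv], [integral_dlayer2]).  Poisson kernels
    form a convolution semigroup, P_p * P_q = pi P_(p+q).  So after exchanging
    integrals, the x-integral at heights p and q is phi(t) + phi(s) - phi(t-s)
    with phi(r) = pi (P_(p+q)(0) - P_(p+q)(r)).  This already has the form of
    the answer.  The exchange is legitimate because P_p(A) - P_p(B) has the
    same sign for all p: the integral of absolute values is the integral of
    |K_H(t, x) K_H'(s, x)|, finite because both kernels are in L^2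
    ([integral_dlayer_prod]).

    Integration over the heights ([ebeta_conv], [integral_bump]).  The
    weight p^a q^b and a function of p + q integrate to
    B(a+1, b+1) times a one-dimensional integral, which by scaling is
    |r|^(H+H') times an integral evaluated by the reflection formula.
    The outcome is
      k_H k_H' / (Gamma(H+H'+1) sin(pi (H+H')/2)) (|t|^h + |s|^h - |t-s|^h)/2,
    h = H + H', and the first denominator is the inverse of d_m^2 / k_m^2 at
    m = h/2 ([dconst_kconst]).

    Reflection formula ([mellin_inv1DE]).  Let K(w) be the integral of
    u^(w-1)/(1+u) over the half line; it has to be pi / sin(pi w).  Multiplying
    K(w) and K(v) and separating by partial fractions ([mellin_inv1D_mul])
    shows that S = pi/K obeys the addition formula of the sine
    ([mellin_sine_add]) with S(1/2) = 1.  Hence S(w) is the sine of an angle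
    that doubles when w doubles, and the crude bound K(w) <= 1/w + 1/(1-w),
    applied at w/2^n, shows that this angle is at least pi w.  As the angles of
    w and 1/2 - w add up to pi/2, it equals pi w.

    Integrals over the half line are written in the variable log u (or log p)
    over the whole line, with no Jacobian left to handle: changes of scale
    become translations, under which Lebesgue measure is invariant. *)

(** * Lebesgue integrals on the line and in the plane *)

Section real_line.
Context {R : realType}.
Local Notation mu := (@lebesgue_measure R).
Implicit Types (f g F : R -> R).

Lemma ge0_integral_affine (a b : R) (f : R -> \bar R) : 0 < a ->
  measurable_fun [set: R] f -> (forall x, (0 <= f x)%E) ->
  (\int[mu]_x f (a * x + b)%R = a^-1%:E * \int[mu]_x f x)%E.
Proof.
move=> a0 mf f0.
have mphi : measurable_fun [set: measurableTypeR R]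
    (fun x : measurableTypeR R => (a * x + b : measurableTypeR R)).
  by apply: measurable_funD => //; exact: measurable_funM.
have key A : measurable A -> mu A =
    mscale (NngNum (ltW a0)) (pushforward mu (fun x : measurableTypeR R =>
      (a * x + b : measurableTypeR R))) A.
  apply: lebesgue_measure_unique => _ [[u v]] _ <- /=.
  rewrite /mscale/= /pushforward.
  have -> : (fun x : R => a * x + b) @^-1` `]u, v] =
      `](u - b) / a, (v - b) / a]%classic.
    apply/seteqP; split => x /=; rewrite !in_itv/= ltr_pdivrMr// ler_pdivlMr//.
      by move=> /andP[h1 h2]; apply/andP; split; lra.
    by move=> /andP[h1 h2]; apply/andP; split; lra.
  rewrite !lebesgue_measure_itv/= !lte_fin ltr_pM2r ?invr_gt0// ltrD2r.
  case: ifPn => _; last by rewrite mule0.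
  rewrite -!EFinD -EFinM; congr EFin.
  by field; rewrite gt_eqF.
rewrite [in RHS](eq_measure_integral _ (fun A mA _ => key mphi A mA)).
rewrite ge0_integral_mscale//= muleA -EFinM mulVf ?gt_eqF// mul1e.
by rewrite ge0_integral_pushforward.
Qed.

Lemma ge0_integral_opp (f : R -> \bar R) :
  measurable_fun [set: R] f -> (forall x, (0 <= f x)%E) ->
  (\int[mu]_x f (- x)%R = \int[mu]_x f x)%E.
Proof.
move=> mf f0.
transitivity (\int[pushforward mu (-%R : _ -> measurableTypeR R)]_x f x)%E.
  by rewrite ge0_integral_pushforward.
by apply: eq_measure_integral => A mA _; exact: lebesgue_measureN.
Qed.

Local Notation seg n := (`[(- n%:R)%R, (n%:R : R)%R]%classic).

Lemma cvgn_integral_itvNn (f : R -> \bar R) :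
  measurable_fun [set: R] f -> (forall x, (0 <= f x)%E) ->
  (\int[mu]_(x in seg n) f x @[n --> \oo] --> \int[mu]_x f x)%E.
Proof.
move=> mf f0.
have -> : [set: R] = \bigcup_n seg n.
  apply/esym/seteqP; split => // x _.
  exists (Num.trunc `|x|).+1 => //=; rewrite in_itv/= -ler_norml ltW//.
  exact: truncnS_gt.
apply: ge0_nondecreasing_set_cvg_integral => //.
- move=> m n mn; apply/subsetPset => x /=; rewrite !in_itv/= => /andP[h1 h2].
  have : (m%:R : R) <= n%:R by rewrite ler_nat.
  by move=> ?; apply/andP; split; lra.
- by move=> i; exact: measurable_funS mf.
Qed.

(** The signed derivative of [F] is split into two nonnegative parts so that
    no integrability is required: both sides are limits of integrals over
    [[-n, n]] and may be infinite. *)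
Lemma ge0_integral_FTC (f g F : R -> R) (l m : R) :
  continuous f -> continuous g -> (forall x, 0 <= f x) -> (forall x, 0 <= g x) ->
  (forall x : R, is_derive x 1 F (f x - g x)) ->
  F x @[x --> +oo] --> l -> F x @[x --> -oo] --> m ->
  (\int[mu]_x (f x)%:E + m%:E = \int[mu]_x (g x)%:E + l%:E)%E.
Proof.
move=> cf cg f0 g0 dF Fl Fm.
have mE (h : R -> R) : continuous h -> measurable_fun [set: R] (EFin \o h).
  by move=> ch; apply/measurable_EFinP; exact: continuous_measurable_fun.
have cFf (h : R -> R) : continuous h -> (forall x, 0 <= h x) ->
  (\int[mu]_(x in seg n) (h x)%:E @[n --> \oo] --> \int[mu]_x (h x)%:E)%E.
  by move=> ch h0; apply: (cvgn_integral_itvNn (mE h ch)) => x; rewrite lee_fin.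
have Fl' : (F n%:R%R)%:E @[n --> \oo] --> l%:E.
  apply: cvg_EFin; first exact: nearW.
  exact: (cvg_comp _ _ cvgr_idn Fl).
have Fm' : (F (- n%:R)%R)%:E @[n --> \oo] --> m%:E.
  apply: cvg_EFin; first exact: nearW.
  apply: (cvg_comp _ _ _ Fm); apply/cvgNrNy; exact: cvgr_idn.
have cont : continuous F.
  by move=> x; apply: differentiable_continuous; apply/derivable1_diffP; exact: ex_derive.
have key n : (\int[mu]_(x in seg n) (f x)%:E + (F (- n%:R)%R)%:E =
   \int[mu]_(x in seg n) (g x)%:E + (F n%:R%R)%:E)%E.
  case: n => [|n].
    by rewrite oppr0 set_itv1 !integral_set1.
  have lt : - n.+1%:R < n.+1%:R :> R by rewrite gtrN.
  have ii (h : R -> R) : continuous h -> mu.-integrable (seg n.+1) (EFin \o h).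
    move=> ch; apply: continuous_compact_integrable => //; first exact: segment_compact.
    exact: continuous_subspaceT.
  have /= : (\int[mu]_(x in (seg n.+1)) ((f \- g) x)%:E =
      (F n.+1%:R%R)%:E - (F (- n.+1%:R)%R)%:E)%E.
    apply: continuous_FTC2 => //.
    by apply: continuous_subspaceT => x; apply: cvgB; [exact: cf|exact: cg].
    split; first by move=> x _; exact: ex_derive.
      by apply: cvg_at_right_filter; exact: cont.
    by apply: cvg_at_left_filter; exact: cont.
    by move=> x _; rewrite derive1E (@derive_val _ _ _ _ _ _ _ (dF x)).
  rewrite [X in (X = _)%E -> _](_ : _ = \int[mu]_(x in seg n.+1) ((EFin \o f) x - (EFin \o g) x))%E; last by [].
  rewrite integralB; [|by []|exact: ii|exact: ii].
  have : (\int[mu]_(x in (seg n.+1)) (f x)%:E \is a fin_num)%E.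
    by apply: integrable_fin_num => //; exact: ii.
  have : (\int[mu]_(x in (seg n.+1)) (g x)%:E \is a fin_num)%E.
    by apply: integrable_fin_num => //; exact: ii.
  case: (integral _ _ _) => // u _; case: (integral _ _ _) => // v _.
  by rewrite -!EFinD => -[?]; congr EFin; lra.
have h1 : (\int[mu]_(x in seg n) (f x)%:E + (F (- n%:R)%R)%:E @[n --> \oo] -->
    \int[mu]_x (f x)%:E + m%:E)%E.
  by apply: cvgeD => //; [exact: fin_num_adde_defl|exact: cFf].
have h2 : (\int[mu]_(x in seg n) (f x)%:E + (F (- n%:R)%R)%:E @[n --> \oo] -->
    \int[mu]_x (g x)%:E + l%:E)%E.
  under eq_fun do rewrite key.
  by apply: cvgeD => //; [exact: fin_num_adde_defl|exact: cFf].
exact: (cvg_unique _ h1 h2).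
Qed.

End real_line.

Section measurability_null_sets.
Context {R : realType}.
Local Notation mu := (@lebesgue_measure R).

(** [x^-1 = x * (x ^+ 2)^-1], also at 0, which reduces the inverse to a real
    power of a nonnegative number. *)
Lemma measurable_inv : measurable_fun [set: R] (@GRing.inv R).
Proof.
have -> : @GRing.inv R = (fun x => x * ((x ^+ 2) `^ (-1))).
  apply/funext => x; rewrite powR_inv1 ?sqr_ge0//.
  by have [->|x0] := eqVneq x 0; rewrite ?mul0r ?invr0// expr2 invfM mulrA mulfV// mul1r.
apply: measurable_funM => //.
by apply: (measurableT_comp (measurable_powR _)); exact: measurable_funX.
Qed.

Lemma measurable_funV d (T : measurableType d) (D : set T) (f : T -> R) :
  measurable_fun D f -> measurable_fun D (fun x => (f x)^-1).
Proof. by move=> mf; apply: (measurableT_comp measurable_inv). Qed.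

Lemma derivable_continuousT (f : R -> R) :
  (forall x : R, derivable f x 1) -> continuous f.
Proof.
by move=> df x; apply: differentiable_continuous; exact/derivable1_diffP.
Qed.

Lemma integral_gt0 (f : R -> R) : measurable_fun [set: R] f ->
  (forall x, 0 < f x) -> (0 < \int[mu]_x (f x)%:E)%E.
Proof.
move=> mf f0; rewrite lt0e; apply/andP; split; last first.
  by apply: integral_ge0 => x _; rewrite lee_fin ltW.
apply/eqP => i0.
have /(ae_eq_integral_abs mu measurableT) : measurable_fun [set: R] (EFin \o f).
  exact/measurable_EFinP.
move=> [+ _]; have -> : (\int[mu]_x `|(EFin \o f) x| = \int[mu]_x (f x)%:E)%E.
  by apply: eq_integral => x _; rewrite /= gtr0_norm.
move=> /(_ i0)[N [mN N0 sub]].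
have : mu `[0, 1]%classic = 0%E.
  apply: (subset_measure0 _ mN _ N0) => // x _; apply: sub => /= /(_ I) [] fx0.
  by move: (f0 x); rewrite fx0 ltxx.
by rewrite lebesgue_measure_itv/= lte_fin ltr01 oppr0 addr0 => -[] /eqP; rewrite oner_eq0.
Qed.

Lemma eq_integral_setC1 (a : R) (f g : R -> \bar R) :
  measurable_fun [set: R] f -> measurable_fun [set: R] g ->
  (forall x, x != a -> f x = g x) ->
  (\int[mu]_x f x = \int[mu]_x g x)%E.
Proof.
move=> mf mg fg; apply: ae_eq_integral => //.
exists [set a]; split => //; first exact: lebesgue_measure_set1.
by move=> x /= /not_implyP[_ fgx]; apply: contrapT => /eqP xa; apply: fgx; exact: fg.
Qed.

Lemma integral_swap (f : R -> R -> R) :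
  measurable_fun [set: R * R] (fun p => f p.1 p.2) -> (forall x y, 0 <= f x y) ->
  (\int[mu]_x \int[mu]_y (f x y)%:E = \int[mu]_y \int[mu]_x (f x y)%:E)%E.
Proof.
move=> mf f0.
apply: (fubini_tonelli (m1 := mu) (m2 := mu) (fun p => (f p.1 p.2)%:E)).
  exact/measurable_EFinP.
by move=> p; rewrite lee_fin.
Qed.

End measurability_null_sets.

Section integral_order_linear.
Context d (T : measurableType d) {R : realType} (nu : {measure set T -> \bar R}).

Lemma integralZlr (c : R) (f : T -> R) : 0 <= c ->
  measurable_fun [set: T] f -> (forall x, 0 <= f x) ->
  (\int[nu]_x (c * f x)%:E = c%:E * \int[nu]_x (f x)%:E)%E.
Proof.
move=> c0 mf f0; under eq_integral do rewrite EFinM.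
apply: ge0_integralZl_EFin => //.
- by move=> x _; rewrite lee_fin.
- exact/measurable_EFinP.
Qed.

Lemma le_integralr (f g : T -> R) :
  measurable_fun [set: T] f -> measurable_fun [set: T] g ->
  (forall x, 0 <= f x) -> (forall x, f x <= g x) ->
  (\int[nu]_x (f x)%:E <= \int[nu]_x (g x)%:E)%E.
Proof.
move=> mf mg f0 fg; apply: ge0_le_integral => //.
- by move=> x _; rewrite lee_fin.
- exact/measurable_EFinP.
- exact/measurable_EFinP.
- by move=> x _; rewrite lee_fin.
Qed.

End integral_order_linear.

(** Proves measurability by following the syntax of the function; the lemmas
    are given explicit functions because unification up to conversion would
    unfold [expR] and the like. *)
Ltac meas := repeat lazymatch goal with
  | |- measurable_fun _ (fun=> ?c) => exact: measurable_cst
  | |- measurable_fun _ (fun x => x) => exact: measurable_id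
  | |- measurable_fun _ fst => exact: measurable_fst
  | |- measurable_fun _ snd => exact: measurable_snd
  | |- measurable_fun _ (fun x => EFin (@?f x)) => apply/measurable_EFinP; rewrite /comp
  | |- measurable_fun _ (fun x => fst (@?f x)) => apply: (measurableT_comp measurable_fst)
  | |- measurable_fun _ (fun x => snd (@?f x)) => apply: (measurableT_comp measurable_snd)
  | |- measurable_fun _ (fun x => GRing.inv (@?f x)) => apply: (@measurable_funV _ _ _ _ f)
  | |- measurable_fun _ (fun x => GRing.exp (@?f x) ?n) => apply: (@measurable_funX _ _ _ _ f n)
  | |- measurable_fun _ (fun x => - @?f x) => apply: (@measurable_funN _ _ _ _ f)
  | |- measurable_fun _ (fun x => @?f x + @?g x) => apply: (@measurable_funD _ _ _ _ f g)
  | |- measurable_fun _ (fun x => @?f x * @?g x) => apply: (@measurable_funM _ _ _ _ f g)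
  | |- measurable_fun _ (fun x => `|@?f x|) => apply: (measurableT_comp (@normr_measurable _ setT) (g := f))
  | |- measurable_fun _ (fun x => expR (@?f x)) => apply: (measurableT_comp (@measurable_expR _) (g := f))
  | |- measurable_fun _ (fun x => ln (@?f x)) => apply: (measurableT_comp (@measurable_ln _) (g := f))
  | |- measurable_fun _ (fun x => powR (@?f x) ?n) => apply: (measurableT_comp (@measurable_powR _ n) (g := f))
  end.

Section integral_linear_shift.
Context {R : realType}.
Local Notation mu := (@lebesgue_measure R).

Lemma ge0_integral_lin d (T : measurableType d) (nu : {measure set T -> \bar R})
    (a b : R) (f g h : T -> R) : 0 <= a -> 0 <= b ->
  measurable_fun [set: T] f -> measurable_fun [set: T] g ->
  (forall x, 0 <= f x) -> (forall x, 0 <= g x) ->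
  (forall x, h x = a * f x + b * g x) ->
  (\int[nu]_x (h x)%:E = a%:E * \int[nu]_x (f x)%:E + b%:E * \int[nu]_x (g x)%:E)%E.
Proof.
move=> a0 b0 mf mg f0 g0 hE.
have mf' : measurable_fun [set: T] (EFin \o f) by exact/measurable_EFinP.
have mg' : measurable_fun [set: T] (EFin \o g) by exact/measurable_EFinP.
rewrite -ge0_integralZl_EFin//; last by move=> x _; rewrite lee_fin.
rewrite -ge0_integralZl_EFin//; last by move=> x _; rewrite lee_fin.
rewrite -ge0_integralD//.
- by apply: eq_integral => x _; rewrite hE EFinD !EFinM.
- by move=> x _; rewrite -EFinM lee_fin mulr_ge0.
- exact: measurable_funeM.
- by move=> x _; rewrite -EFinM lee_fin mulr_ge0.
- exact: measurable_funeM.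
Qed.

Lemma ge0_integral_shift (b : R) (f : R -> R) :
  measurable_fun [set: R] f -> (forall x, 0 <= f x) ->
  (\int[mu]_x (f (x + b))%:E = \int[mu]_x (f x)%:E)%E.
Proof.
move=> mf f0.
rewrite -[RHS]mul1e -[1%E]/(1%:E) -{1}(@invr1 R).
rewrite -(@ge0_integral_affine R 1 b (EFin \o f))//.
- by apply: eq_integral => x _; rewrite mul1r.
exact/measurable_EFinP.
Qed.

End integral_linear_shift.

Section lebesgue_plane.
Context {R : realType}.
Local Notation mu := (@lebesgue_measure R).
Local Notation RR := (measurableTypeR R).

(** Named so that the product measure carries a sigma-finite structure and
    can itself be a factor in the theorem of Fubini. *)
Definition lebesgue2 : set (RR * RR) -> \bar R := (mu \x mu)%E.

HB.instance Definition _ := Measure.on lebesgue2.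

Let sigma_finite_lebesgue2 : sigma_finite setT lebesgue2.
Proof.
have /sigma_finiteP[F [TF ndF Foo]] := sigma_finiteT mu.
exists (fun n => F n `*` F n).
  rewrite -setXTT TF predeqE => -[x y]; split.
    move=> [/= [n _ Fnx] [k _ Fky]]; exists (maxn n k) => //; split.
    - by move: x Fnx; exact/subsetPset/ndF/leq_maxl.
    - by move: y Fky; exact/subsetPset/ndF/leq_maxr.
  by move=> [n _ []/= ? ?]; split; exists n.
move=> k; have [? ?] := Foo k; split; first exact: measurableX.
by rewrite /lebesgue2 product_measure1E// lte_mul_pinfty// ge0_fin_numE.
Qed.

HB.instance Definition _ :=
  Measure_isSigmaFinite.Build _ _ _ lebesgue2 sigma_finite_lebesgue2.

End lebesgue_plane.

Section tensor_product.
Context {R : realType}.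
Local Notation mu := (@lebesgue_measure R).
Local Notation mu2 := (@lebesgue2 R).

Lemma integral_subr d (T : measurableType d) (nu : {measure set T -> \bar R})
    (f g : T -> R) (u v : R) :
  measurable_fun [set: T] f -> measurable_fun [set: T] g ->
  (forall x, 0 <= f x) -> (forall x, 0 <= g x) ->
  (\int[nu]_x (f x)%:E = u%:E)%E -> (\int[nu]_x (g x)%:E = v%:E)%E ->
  (\int[nu]_x (f x - g x)%:E = (u - v)%:E)%E.
Proof.
move=> mf mg f0 g0 fu gv.
have ii (h : T -> R) c : measurable_fun [set: T] h -> (forall x, 0 <= h x) ->
    (\int[nu]_x (h x)%:E = c%:E)%E -> nu.-integrable [set: T] (EFin \o h).
  move=> mh h0 hc; apply/integrableP; split; first exact/measurable_EFinP.
  rewrite (_ : (\int[nu]_x `|(EFin \o h) x|)%E = c%:E) ?ltry// -hc.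
  by apply: eq_integral => x _; rewrite /= ger0_norm.
under eq_integral do rewrite EFinB.
by rewrite integralB_EFin ?fu ?gv//; [exact: (ii _ u)|exact: (ii _ v)].
Qed.

Lemma eq_integral_countable (N : set R) (f g : R -> \bar R) : countable N ->
  measurable_fun [set: R] f -> measurable_fun [set: R] g ->
  (forall x, ~ N x -> f x = g x) -> (\int[mu]_x f x = \int[mu]_x g x)%E.
Proof.
move=> cN mf mg fg; apply: ae_eq_integral => //.
exists N; split; [exact: countable_measurable|exact: countable_lebesgue_measure0|].
by move=> x /= /not_implyP[_ fgx]; apply: contrapT => Nx; apply: fgx; exact: fg.
Qed.

Lemma integral_tensor (f g : R -> R) (A B u v : R) :
  measurable_fun [set: R] f -> measurable_fun [set: R] g ->
  (\int[mu]_x `|f x|%:E = A%:E)%E -> (\int[mu]_x `|g x|%:E = B%:E)%E ->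
  (\int[mu]_x (f x)%:E = u%:E)%E -> (\int[mu]_x (g x)%:E = v%:E)%E ->
  (\int[mu2]_p `|f p.1 * g p.2|%:E = (A * B)%:E)%E /\
  (\int[mu2]_p (f p.1 * g p.2)%:E = (u * v)%:E)%E.
Proof.
move=> mf mg fA gB fu gv.
have mfg : measurable_fun [set: R * R] (fun p => f p.1 * g p.2).
  apply: measurable_funM; first exact: (measurableT_comp mf).
  exact: (measurableT_comp mg).
have mnf : measurable_fun [set: R] (fun x => `|f x|) by exact: measurableT_comp.
have mng : measurable_fun [set: R] (fun x => `|g x|) by exact: measurableT_comp.
have intg : mu.-integrable [set: R] (EFin \o g).
  by apply/integrableP; split; [exact/measurable_EFinP|rewrite /= gB ltry].
have intf : mu.-integrable [set: R] (EFin \o f).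
  by apply/integrableP; split; [exact/measurable_EFinP|rewrite /= fA ltry].
have e1 : (\int[mu]_x \int[mu]_y `|f x * g y|%:E = (A * B)%:E)%E.
  transitivity (\int[mu]_x (`|f x| * B)%:E)%E.
    apply: eq_integral => x _; under eq_integral do rewrite normrM.
    by rewrite integralZlr// gB.
  have [B0] : 0 <= B by rewrite -lee_fin -gB; apply: integral_ge0 => x _; rewrite lee_fin.
  by under eq_integral do rewrite mulrC; rewrite integralZlr// fA -EFinM mulrC.
have ifg : mu2.-integrable setT (fun p : R * R => (f p.1 * g p.2)%:E).
  by apply/integrable12ltyP; [exact/measurable_EFinP|rewrite /= e1 ltry].
split.
  rewrite fubini_tonelli1//.
  by apply/measurable_EFinP; exact: measurableT_comp.
rewrite -integral12_prod_meas1// /fubini_F /=.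
transitivity (\int[mu]_x (v%:E * (f x)%:E))%E.
  apply: eq_integral => x _; under eq_integral do rewrite EFinM.
  by rewrite integralZl// gv muleC.
by rewrite integralZl// fu -EFinM mulrC.
Qed.

End tensor_product.

(** * The Mellin transform of 1/(1+u) and the reflection formula *)

Section mellin.
Context {R : realType}.
Local Notation mu := (@lebesgue_measure R).
Implicit Types (w v u x y r : R).

(** The integral of [u^(w-1) / (1 + u)] over the half line, with
    [u = expR x]. *)
Definition mellin_inv1D w : \bar R := \int[mu]_x (expR (w * x) / (1 + expR x))%:E.

Lemma gt0_1pexpR x : 0 < 1 + expR x.
Proof. by rewrite addr_gt0// expR_gt0. Qed.

Lemma cvgNy_expRM (a : R) : 0 < a -> expR (a * x) @[x --> -oo] --> (0:R).
Proof.
move=> a0.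
have -> : (fun x => expR (a * x)) = (fun x => expR (- x)) \o (fun x => a * - x).
  by apply/funext => x /=; rewrite mulrN opprK.
apply: cvg_comp; last exact: cvgr_expR.
apply: gt0_cvgMry => //.
by apply/(cvgNry (id : R -> R)); exact: cvg_id.
Qed.

Lemma cvgy_expRNM (a : R) : 0 < a -> expR (- (a * x)) @[x --> +oo] --> (0:R).
Proof.
move=> a0.
apply: (cvg_comp (fun x => a * x) (fun x => expR (- x))); last exact: cvgr_expR.
exact: gt0_cvgMry.
Qed.

Lemma cvgy_expR : @expR R x @[x --> +oo] --> +oo.
Proof.
apply/cvgryPge => A; near=> x.
apply: le_trans (expR_ge1Dx x).
rewrite -lerBlDl; near: x; apply: nbhs_pinfty_ge; exact: num_real.
Unshelve. all: by end_near. Qed.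

Lemma integral_expRN (a : R) : 0 < a ->
  (\int[mu]_(x in `[0%R, +oo[) (expR (- (a * x)))%:E = a^-1%:E)%E.
Proof.
move=> a0.
rewrite (@ge0_continuous_FTC2y R _ (fun x => - (expR (- (a * x)) / a)) 0 0)//.
- by rewrite mulr0 oppr0 expR0 EFinN oppeK add0e div1r.
- apply: continuous_subspaceT; apply: derivable_continuousT => x; exact: ex_derive.
- rewrite -oppr0; apply: cvgN; rewrite -(mul0r a^-1); apply: cvgM; [exact: cvgy_expRNM|exact: cvg_cst].
- apply: cvg_at_right_filter.
  have : continuous (fun x => - (expR (- (a * x)) / a)).
    apply: derivable_continuousT => x; exact: ex_derive.
  exact.
- move=> x _; rewrite derive1E.
  have : is_derive x 1 (fun x => - (expR (- (a * x)) / a)) (expR (- (a * x))).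
    by apply: is_derive_eq; rewrite /GRing.scale/=; field; rewrite gt_eqF.
  by move=> h; rewrite derive_val.
Qed.

Lemma continuous_mellin_inv1D w : continuous (fun x => expR (w * x) / (1 + expR x)).
Proof.
move=> x; apply: cvgM.
  by have := @derivable_continuousT R (fun x => expR (w * x)); apply => y; exact: ex_derive.
apply: cvgV; first by rewrite gt_eqF// gt0_1pexpR.
by have := @derivable_continuousT R (fun x => 1 + expR x); apply => y; exact: ex_derive.
Qed.

(** The substitution of [1/u] for [u]. *)
Lemma mellin_inv1D_onem w : mellin_inv1D (1 - w) = mellin_inv1D w.
Proof.
rewrite -[RHS]ge0_integral_opp.
- apply: eq_integral => x _; congr EFin.
  rewrite mulrBl mul1r expRB expRN mulrN expRN.
  have := expR_gt0 x; have := expR_gt0 (w * x); move: (expR _) (expR _) => A B A0 B0.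
  by field; rewrite ?gt_eqF ?addr_gt0.
- by meas.
- by move=> x; rewrite lee_fin divr_ge0 ?expR_ge0// ltW// gt0_1pexpR.
Qed.

(** Bound [1/(1+u)] by 1 below [u = 1] and by [1/u] above.  The bound is
    crude, but it is [1/w + O(1)] at [w = 0], with the exact leading term;
    this is what pins down the angle in [mellin_angle_ge]. *)
Lemma mellin_inv1D_le w : 0 < w < 1 -> (mellin_inv1D w <= (w^-1 + (1 - w)^-1)%:E)%E.
Proof.
move=> /andP[w0 w1].
have mK : measurable_fun [set: R] (fun x => (expR (w * x) / (1 + expR x))%:E).
  by apply/measurable_EFinP; apply: continuous_measurable_fun; exact: continuous_mellin_inv1D.
have K0 x : (0 <= (expR (w * x) / (1 + expR x))%:E)%E.
  by rewrite lee_fin divr_ge0 ?expR_ge0// ltW// gt0_1pexpR.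
rewrite /mellin_inv1D.
have <- : `]-oo, 0%R] `|` `]0%R, +oo[ = [set: R].
  by apply/seteqP; split => // x _ /=; rewrite !in_itv/= andbT; case: (ltP 0 x); [right|left].
rewrite ge0_integral_setU//=; [|exact: measurable_funS mK|]; last first.
  apply/disj_setPS => x /= []; rewrite !in_itv/= andbT => h1 h2.
  by move: (le_lt_trans h1 h2); rewrite ltxx.
rewrite EFinD; apply: leeD.
  have := @ge0_integration_by_substitution0 R (fun x => (expR (w * - x) / (1 + expR (- x)))%:E).
  under [X in _ -> _ -> _ = X]eq_integral do rewrite opprK.
  move=> <-; first last.
  - by move=> r; have := K0 (- r).
  - exact: (measurableT_comp mK).
  rewrite -(integral_expRN w0); apply: ge0_le_integral => //.
  - by apply: measurable_funTS; exact: (measurableT_comp mK (@oppr_measurable R _)).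
  - by apply: measurable_funTS; meas.
  - move=> x _; rewrite lee_fin mulrN ler_pdivrMr ?gt0_1pexpR// ler_peMr ?expR_ge0//.
    by rewrite lerDl expR_ge0.
have w1' : 0 < 1 - w by rewrite subr_gt0.
rewrite -(integral_expRN w1').
rewrite integral_itv_obnd_cbnd//; last exact: measurable_funTS.
apply: ge0_le_integral => //.
- by apply: measurable_funTS.
- by apply: measurable_funTS; meas.
- move=> x _; rewrite lee_fin ler_pdivrMr ?gt0_1pexpR//.
  rewrite mulrDr mulr1 -expRD.
  rewrite (_ : - ((1 - w) * x) + x = w * x); last by ring.
  by rewrite lerDr expR_ge0.
Qed.

(** The integrand is the derivative of [2 atan (sqrt u)]. *)
Lemma mellin_inv1D_half : mellin_inv1D 2^-1 = pi%:E.
Proof.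
pose F x : R := 2 * atan (expR (2^-1 * x)).
have := @ge0_integral_FTC R (fun x => expR (2^-1 * x) / (1 + expR x)) (cst 0) F pi 0.
under [X in (_ = X + _)%E]eq_integral do rewrite /=.
rewrite integral0 !add0e adde0; apply.
- exact: continuous_mellin_inv1D.
- by move=> x; exact: cvg_cst.
- by move=> x; rewrite divr_ge0 ?expR_ge0// ltW// gt0_1pexpR.
- by move=> x; rewrite /=.
- move=> x; apply: is_derive_eq; rewrite /GRing.scale/= subr0.
  have -> : expR x = expR (2^-1 * x) ^+ 2.
    by rewrite -expRM_natl; congr expR; field.
  have := expR_gt0 (2^-1 * x); move: (expR _) => A A0.
  by field; rewrite gt_eqF// addr_gt0// exprn_gt0.
- have -> : (pi : R) = 2 * (pi / 2) by field.
  apply: cvgM; first exact: cvg_cst.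
  apply: (cvg_comp (fun x => expR (2^-1 * x)) atan); last exact: cvgy_atan.
  apply: (cvg_comp (fun x => 2^-1 * x) expR); last exact: cvgy_expR.
  exact: gt0_cvgMry.
- rewrite -(mulr0 2) -atan0; apply: cvgM; first exact: cvg_cst.
  apply: continuous_cvg; first exact: continuous_atan.
  exact: cvgNy_expRM.
Qed.

End mellin.

Section mellin_product.
Context {R : realType}.
Local Notation mu := (@lebesgue_measure R).
Local Notation K := (@mellin_inv1D R).
Implicit Types (w v u x y r s : R).

(** The integral of [(u^w - u^v) / (1 - u)] against [du/u], with [u = expR r];
    its value turns out to be [pi cot(pi w) - pi cot(pi v)]. *)
Definition mellin_diff w v : \bar R :=
  \int[mu]_r ((expR (w * r) - expR (v * r)) / (1 - expR r))%:E.

Lemma measurable_mellin_inv1D w : measurable_fun [set: R] (fun x => expR (w * x) / (1 + expR x)).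
Proof. by meas. Qed.

Lemma ge0_mellin_inv1D w x : 0 <= expR (w * x) / (1 + expR x).
Proof. by rewrite divr_ge0 ?expR_ge0// ltW// gt0_1pexpR. Qed.

Lemma mellin_inv1D_gt0 w : (0 < K w)%E.
Proof.
apply: (integral_gt0 (measurable_mellin_inv1D w)) => x.
rewrite divr_gt0 ?expR_gt0// gt0_1pexpR.
Qed.

Lemma mellin_inv1D_fin w : 0 < w < 1 -> K w = (fine (K w))%:E.
Proof.
move=> w01; rewrite fineK// ge0_fin_numE ?(ltW (mellin_inv1D_gt0 w))//.
exact: le_lt_trans (mellin_inv1D_le w01) (ltry _).
Qed.

(** Partial fractions: with [u = expR y] and [c = expR r],
    [(1 - c) / ((1 + cu)(1 + u)) = 1/(1 + u) - c/(1 + cu)], and the integral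
    of the second term is that of the first translated by [r].  The proof
    distinguishes the sign of [1 - c] to keep all integrands nonnegative. *)
Lemma mellin_inv1D_inner s r : 0 < s < 1 -> r != 0 ->
  (\int[mu]_y (expR (s * y) / ((1 + expR (y + r)) * (1 + expR y)))%:E =
   K s * ((1 - expR ((1 - s) * r)) / (1 - expR r))%:E)%E.
Proof.
move=> s01 r0.
pose f y := expR (s * y) / ((1 + expR (y + r)) * (1 + expR y)).
pose g y := expR (s * y) / (1 + expR (y + r)).
pose k y := expR (s * y) / (1 + expR y).
have mf : measurable_fun [set: R] f by rewrite /f; meas.
have mg : measurable_fun [set: R] g by rewrite /g; meas.
have mk : measurable_fun [set: R] k by rewrite /k; meas.
have P y : 0 < 1 + expR (y + r) by exact: gt0_1pexpR.
have Q y : 0 < 1 + expR y by exact: gt0_1pexpR.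
have f0 y : 0 <= f y by rewrite divr_ge0 ?expR_ge0// mulr_ge0// ltW.
have g0 y : 0 <= g y by rewrite divr_ge0 ?expR_ge0// ltW.
have k0 y : 0 <= k y by rewrite divr_ge0 ?expR_ge0// ltW.
have gE : (\int[mu]_y (g y)%:E = (expR (- (s * r)))%:E * K s)%E.
  have -> : K s = (\int[mu]_y (k (y + r))%:E)%E by rewrite (ge0_integral_shift r mk k0).
  rewrite -ge0_integralZl_EFin ?expR_ge0//.
  - apply: eq_integral => y _; rewrite -EFinM; congr EFin.
    by rewrite /k mulrA -expRD mulrDr addrA addrAC addNr add0r /g.
  - by move=> y _; rewrite lee_fin k0.
  - by rewrite /k; meas.
have fk : (\int[mu]_y (f y)%:E <= K s)%E.
  apply: ge0_le_integral => //.
  - by move=> x _; rewrite lee_fin.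
  - exact/measurable_EFinP.
  - exact/measurable_EFinP.
  - move=> x _; rewrite lee_fin /f invfM mulrCA ler_piMl ?k0//.
    by rewrite invf_le1// lerDl expR_ge0.
have : (\int[mu]_y (f y)%:E \is a fin_num)%E.
  rewrite ge0_fin_numE; last by apply: integral_ge0 => y _; rewrite lee_fin.
  by rewrite (le_lt_trans fk)// (mellin_inv1D_fin s01) ltry.
change ((\int[mu]_y (f y)%:E \is a fin_num)%E -> \int[mu]_y (f y)%:E = K s * ((1 - expR ((1 - s) * r)) / (1 - expR r))%:E)%E.
have fkg y : (1 - expR r) * f y + expR r * g y = k y.
  rewrite /f /g /k !expRD.
  have := gt0_1pexpR y; have := P y; rewrite expRD.
  move: (expR y) (expR r) (expR (s * y)) => A B C AB A1.
  by field; rewrite !gt_eqF.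
have e1 : expR ((1 - s) * r) = expR r * expR (- (s * r)).
  by rewrite -expRD mulrBl mul1r.
have alg (k1 c d i : R) : 1 - c != 0 -> (1 - c) * i = k1 - c * (d * k1) ->
    i = k1 * ((1 - c * d) / (1 - c)).
  by move=> nz h; apply: (mulfI nz); rewrite h; field.
have nz : 1 - expR r != 0.
  by rewrite subr_eq0 eq_sym -expR0; apply: contra r0 => /eqP/expR_inj ->.
rewrite e1 (mellin_inv1D_fin s01).
have [rlt|rgt|/eqP] := ltgtP r 0; last by rewrite (negbTE r0).
- have := @ge0_integral_lin _ _ _ mu (1 - expR r) (expR r) f g k.
  have cr : 0 <= 1 - expR r by rewrite subr_ge0 -expR0 ler_expR ltW.
  move=> /(_ cr (expR_ge0 _) mf mg f0 g0 (fun x => esym (fkg x))).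
  rewrite gE -[LHS in LHS = _ -> _]/(K s) (mellin_inv1D_fin s01).
  case: (integral _ _ _) => // i + _.
  rewrite -!EFinM -EFinD => -[h]; congr EFin; apply: alg => //.
  by lra.
- have := @ge0_integral_lin _ _ _ mu (expR r - 1) 1 f k (fun y => expR r * g y).
  have cr : 0 <= expR r - 1 by rewrite subr_ge0 -{1}expR0 ler_expR ltW.
  move=> /(_ cr ler01 mf mk f0 k0).
  rewrite (_ : (\int[mu]_y (expR r * g y)%:E)%E = ((expR r)%:E * \int[mu]_y (g y)%:E)%E); last first.
    rewrite -ge0_integralZl_EFin ?expR_ge0//; first by move=> y _; rewrite lee_fin.
    exact/measurable_EFinP.
  rewrite gE -[X in (_ * _ + 1 * X)%E]/(K s) (mellin_inv1D_fin s01) mul1e.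
  have h1 y : expR r * g y = (expR r - 1) * f y + 1 * k y.
    by have := fkg y; lra.
  move=> /(_ h1).
  case: (integral _ _ _) => // i + _.
  rewrite -!EFinM -EFinD => -[h]; congr EFin; apply: alg => //; lra.
Qed.

End mellin_product.

Section mellin_defs.
Context {R : realType}.
Local Notation mu := (@lebesgue_measure R).

Lemma mellin_inv1D_def (w : R) :
  mellin_inv1D w = (\int[mu]_x (expR (w * x) / (1 + expR x))%:E)%E.
Proof. by []. Qed.

Lemma mellin_diff_def (w v : R) :
  mellin_diff w v = (\int[mu]_r ((expR (w * r) - expR (v * r)) / (1 - expR r))%:E)%E.
Proof. by []. Qed.

End mellin_defs.

Section mellin_sine.
Context {R : realType}.
Local Notation mu := (@lebesgue_measure R).
Local Notation K := (@mellin_inv1D R).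
Implicit Types (w v u x y r s : R).

(* Conversion tests between values of these integrals would unfold them down
   to the definition of the Lebesgue integral. *)
Opaque mellin_inv1D mellin_diff.

Lemma mellin_diff_ge0 w v r : w <= v -> 0 <= (expR (w * r) - expR (v * r)) / (1 - expR r).
Proof.
move=> wv; have [r0|r0] := leP r 0.
  apply: divr_ge0; rewrite subr_ge0; last by rewrite -expR0 ler_expR.
  by rewrite ler_expR ler_wnM2r.
rewrite -mulrNN -invrN; apply: divr_ge0; rewrite opprB subr_ge0.
  by rewrite ler_expR ler_wpM2r// ltW.
by rewrite -expR0 ler_expR ltW.
Qed.

(** The addition formula of the sine in disguise, in the form
    [cot x + cot y = sin (x + y) / (sin x sin y)]: write the product as a
    double integral in [y] and [x = y + r], and integrate over [y] first. *)
Lemma mellin_inv1D_mul w v : 0 < w -> 0 < v -> w + v < 1 ->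
  (K w * K v = K (w + v) * mellin_diff w (1 - v))%E.
Proof.
move=> w0 v0 wv.
pose k w x := expR (w * x) / (1 + expR x).
have mk u : measurable_fun [set: R] (k u) by exact: measurable_mellin_inv1D.
have k0 u x : 0 <= k u x by exact: ge0_mellin_inv1D.
have s01 : 0 < w + v < 1 by rewrite wv addr_gt0.
have kk r y : k v y * k w (y + r) = expR (w * r) *
    (expR ((w + v) * y) / ((1 + expR (y + r)) * (1 + expR y))).
  rewrite /k mulrDl mulrDr !expRD.
  have := gt0_1pexpR (y + r); have := gt0_1pexpR y; rewrite expRD => h1 h2.
  by field; rewrite !gt_eqF.
have w1 : 0 < w < 1 by lra.
have Kw : (\int[mu]_x (k w x)%:E = (fine (K w))%:E)%E by rewrite -mellin_inv1D_fin.
have Kw0 : 0 <= fine (K w) by rewrite fine_ge0// ltW// mellin_inv1D_gt0.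
transitivity (\int[mu]_y \int[mu]_r (k v y * k w (y + r))%:E)%E.
  rewrite (mellin_inv1D_fin w1) (_ : K v = \int[mu]_x (k v x)%:E)%E; last by rewrite mellin_inv1D_def.
  rewrite -(integralZlr mu Kw0 (mk v) (k0 v)).
  apply: eq_integral => y _.
  have mky : measurable_fun [set: R] (fun r => k w (y + r)) by rewrite /k; meas.
  rewrite (integralZlr mu (k0 v y) mky (fun r => k0 w _)) mulrC EFinM -Kw; congr (_ * _)%E.
  rewrite -(ge0_integral_shift y (mk w) (k0 w)).
  by apply: eq_integral => r _; rewrite addrC.
have mkk : measurable_fun [set: R * R] (fun p => k v p.1 * k w (p.1 + p.2)).
  by rewrite /k; meas.
rewrite (@integral_swap R (fun y r => k v y * k w (y + r)))//; last first.
  by move=> x y; rewrite mulr_ge0.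
rewrite (mellin_inv1D_fin s01) mellin_diff_def -ge0_integralZl_EFin//; last 3 first.
- by move=> r _; rewrite lee_fin mellin_diff_ge0//; lra.
- by meas.
- by rewrite fine_ge0// ltW// mellin_inv1D_gt0.
apply: (eq_integral_setC1 (a := 0)).
- apply: (@measurable_fun_fubini_tonelli_F _ _ _ _ R mu (fun p => (k v p.2 * k w (p.2 + p.1))%:E)).
    by rewrite /k; meas.
  by move=> p; rewrite lee_fin mulr_ge0.
- by apply/measurable_EFinP; apply: measurable_funM => //; meas.
move=> r r0.
under eq_integral do rewrite kk EFinM.
rewrite ge0_integralZl_EFin ?expR_ge0//; last by meas.
rewrite mellin_inv1D_inner// (mellin_inv1D_fin s01) -!EFinM; congr EFin.
rewrite mulrCA; congr (_ * _); rewrite mulrA; congr (_ / _).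
by rewrite mulrBr mulr1 -expRD; congr (_ - expR _); ring.
Qed.

Lemma mellin_diff_split w u v : w <= u -> u <= v -> (mellin_diff w v = mellin_diff w u + mellin_diff u v)%E.
Proof.
move=> wu uv; rewrite !mellin_diff_def -ge0_integralD//.
- by apply: eq_integral => r _; rewrite -EFinD; congr EFin; rewrite -mulrDl; congr (_ / _); ring.
- by move=> r _; rewrite lee_fin mellin_diff_ge0.
- by meas.
- by move=> r _; rewrite lee_fin mellin_diff_ge0.
- by meas.
Qed.

Lemma mellin_diff_onem w v : w <= v -> (mellin_diff (1 - v) (1 - w) = mellin_diff w v)%E.
Proof.
move=> wv; rewrite !mellin_diff_def.
rewrite -[RHS]ge0_integral_opp; last 2 first.
- by meas.
- by move=> r; rewrite lee_fin mellin_diff_ge0.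
apply: eq_integral => r _; congr EFin.
rewrite !mulrBl !mul1r !expRB !mulrN !expRN.
have [->|r0] := eqVneq r 0; first by rewrite !mulr0 !expR0 !invr1 ?mulr1 !subrr ?mul0r.
have nz : 1 - expR r != 0.
  by rewrite subr_eq0 eq_sym -expR0; apply: contra r0 => /eqP/expR_inj ->.
have nz' : expR r - 1 != 0 by rewrite -opprB oppr_eq0.
have := expR_gt0 r; have := expR_gt0 (w * r); have := expR_gt0 (v * r).
move=> h1 h2 h3; field.
by rewrite nz nz' !gt_eqF.
Qed.

(** This is [sin (pi * w)], see [mellin_sineE]. *)
Definition mellin_sine w : R := pi / fine (K w).

Lemma mellin_inv1D_fine_gt0 w : 0 < w < 1 -> 0 < fine (K w).
Proof. by move=> w01; rewrite fine_gt0// mellin_inv1D_gt0 (mellin_inv1D_fin w01) ltry. Qed.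

(** The product formula at [v = 1/2], where one of the two factors is
    known to be [pi], read as a computation of [mellin_diff]. *)
Lemma mellin_diff_half w : 0 < w < 2^-1 -> (mellin_diff w 2^-1 = (pi * fine (K w) / fine (K (2^-1 - w)))%:E)%E.
Proof.
move=> w01.
have w1 : 0 < w < 1 by lra.
have w2 : 0 < 2^-1 - w < 1 by lra.
have := @mellin_inv1D_mul w 2^-1; rewrite mellin_inv1D_half => /(_ _ _ _)h.
have {h} : (K w * pi%:E = K (w + 2^-1) * mellin_diff w (1 - 2^-1))%E by apply: h; lra.
rewrite (_ : 1 - 2^-1 = 2^-1 :> R); last by field.
rewrite -(mellin_inv1D_onem (w + _)) (_ : 1 - (w + 2^-1) = 2^-1 - w); last by field.
rewrite (mellin_inv1D_fin w1) (mellin_inv1D_fin w2).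
have k2 := mellin_inv1D_fine_gt0 w2.
have : (0 <= mellin_diff w 2^-1)%E by rewrite mellin_diff_def; apply: integral_ge0 => r _; rewrite lee_fin mellin_diff_ge0//; lra.
case: (mellin_diff w 2^-1) => //= [d|] _; last by rewrite gt0_muley ?lte_fin// -EFinM.
by rewrite -!EFinM => -[h]; congr EFin; rewrite [pi * _]mulrC h; field; rewrite gt_eqF.
Qed.

(** Split the [mellin_diff] of the product formula at [1/2] and evaluate both
    parts with [mellin_diff_half]. *)
Lemma mellin_sine_add w v : 0 < w < 2^-1 -> 0 < v < 2^-1 ->
  mellin_sine (w + v) = mellin_sine w * mellin_sine (2^-1 - v) + mellin_sine v * mellin_sine (2^-1 - w).
Proof.
move=> w01 v01.
have w1 : 0 < w < 1 by lra.
have w2 : 0 < 2^-1 - w < 1 by lra.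
have v1 : 0 < v < 1 by lra.
have v2 : 0 < 2^-1 - v < 1 by lra.
have wv : 0 < w + v < 1 by lra.
have : (K w * K v = K (w + v) * mellin_diff w (1 - v))%E by apply: mellin_inv1D_mul; lra.
rewrite (@mellin_diff_split w 2^-1 (1 - v)); [|lra|lra].
rewrite (_ : mellin_diff 2^-1 (1 - v) = mellin_diff v 2^-1); last first.
  rewrite -(@mellin_diff_onem v 2^-1); last lra.
  by rewrite (_ : 1 - 2^-1 = 2^-1 :> R)//; field.
rewrite !mellin_diff_half// (mellin_inv1D_fin w1) (mellin_inv1D_fin v1) (mellin_inv1D_fin wv).
rewrite -EFinD -!EFinM => -[h].
have alg (a b c d e : R) : 0 < a -> 0 < b -> 0 < c -> 0 < d -> 0 < e ->
    a * b = c * (pi * a / d + pi * b / e) -> pi / c = pi / a * (pi / e) + pi / b * (pi / d).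
  move=> a0 b0 c0 d0 e0 abc.
  have -> : pi / c = pi * (a * b) / (c * a * b) :> R by field; rewrite !gt_eqF.
  by rewrite abc; field; rewrite !gt_eqF.
exact: (alg _ _ _ _ _ (mellin_inv1D_fine_gt0 w1) (mellin_inv1D_fine_gt0 v1) (mellin_inv1D_fine_gt0 wv)
  (mellin_inv1D_fine_gt0 w2) (mellin_inv1D_fine_gt0 v2) h).
Qed.

Lemma mellin_sine_half : mellin_sine 2^-1 = 1.
Proof. by rewrite /mellin_sine mellin_inv1D_half/= divff// gt_eqF// pi_gt0. Qed.

Lemma mellin_sine_gt0 w : 0 < w < 1 -> 0 < mellin_sine w.
Proof. by move=> w1; rewrite divr_gt0 ?pi_gt0// mellin_inv1D_fine_gt0. Qed.

Lemma mellin_sine_ge w : 0 < w < 1 -> pi * w * (1 - w) <= mellin_sine w.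
Proof.
move=> w1; rewrite /mellin_sine ler_pdivlMr ?mellin_inv1D_fine_gt0//.
have := mellin_inv1D_le w1; rewrite (mellin_inv1D_fin w1) lee_fin => /(ler_wpM2l _) h.
have w3 : 0 <= pi * w * (1 - w) :> R.
  by rewrite !mulr_ge0 ?pi_ge0//; lra.
apply: (le_trans (h _ w3)).
rewrite le_eqVlt; apply/orP; left; apply/eqP; field.
by apply/andP; split; apply/eqP; lra.
Qed.

End mellin_sine.

Section reflection.
Context {R : realType}.
Local Notation mu := (@lebesgue_measure R).
Local Notation K := (@mellin_inv1D R).
Local Notation S := (@mellin_sine R).
Implicit Types (w v u x y r s : R).

Lemma sin_le_id x : 0 <= x -> sin x <= x.
Proof.
rewrite le_eqVlt => /orP[/eqP <-|x0]; first by rewrite sin0.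
have [] := @MVT R sin cos 0 x x0 (fun y _ => is_derive_sin y).
  by apply: continuous_subspaceT => y; exact: continuous_sin.
move=> c _; rewrite sin0 !subr0 => ->.
by rewrite ler_piMl ?cos_le1// ltW.
Qed.

Definition mellin_angle w : R := asin (S w).
Local Notation al := mellin_angle.

(** The addition formula at [w] and [1/2 - w]: here [mellin_sine (1/2 - w)]
    plays the part of the cosine. *)
Lemma mellin_sine_sqrD w : 0 < w < 2^-1 -> S w ^+ 2 + S (2^-1 - w) ^+ 2 = 1.
Proof.
move=> w01; have h : 0 < 2^-1 - w < 2^-1 by lra.
have := mellin_sine_add w01 h.
rewrite (_ : w + (2^-1 - w) = 2^-1); last by ring.
by rewrite subKr mellin_sine_half -!expr2.
Qed.

Lemma mellin_sine_itv w : 0 < w < 2^-1 -> 0 < S w < 1.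
Proof.
move=> w01; have := mellin_sine_sqrD w01.
have : 0 < S w by apply: mellin_sine_gt0; lra.
have : 0 < S (2^-1 - w) by apply: mellin_sine_gt0; lra.
move: (S w) (S _) => a b b0 a0 h; rewrite a0/= ltNge; apply/negP => a1.
by nra.
Qed.

Lemma sin_mellin_angle w : 0 < w < 2^-1 -> sin (al w) = S w.
Proof.
by move=> /mellin_sine_itv /andP[h1 h2]; apply: asinK; rewrite in_itv/=; apply/andP; split; lra.
Qed.

Lemma cos_mellin_angle w : 0 < w < 2^-1 -> cos (al w) = S (2^-1 - w).
Proof.
move=> w01; have w1 : 0 < 2^-1 - w < 1 by lra.
have := mellin_sine_itv w01; have := mellin_sine_gt0 w1; have := mellin_sine_sqrD w01.
rewrite /mellin_angle; move: (S w) (S (2^-1 - w)) => u v uv v0 /andP[u0 u1].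
rewrite cos_asin; last by apply/andP; split; lra.
by rewrite -uv addrC addKr sqrtr_sqr gtr0_norm.
Qed.

Lemma mellin_angle_itv w : 0 < w < 2^-1 -> 0 <= al w <= pi / 2.
Proof.
move=> w01; have /andP[h1 h2] := mellin_sine_itv w01.
rewrite asin_lepi2 ?andbT; last by apply/andP; split; lra.
rewrite leNgt; apply/negP => al0.
have := sin_mellin_angle w01; rewrite -(opprK (al w)) sinN => h.
have : 0 <= sin (- al w).
  apply: sin_ge0_pi; rewrite oppr_ge0 ltW//=.
  have : -(pi / 2) <= al w by apply: asin_geNpi2; apply/andP; split; lra.
  by have := @pi_gt0 R; lra.
by lra.
Qed.

Lemma mellin_angle_eq w x : 0 < w < 2^-1 -> 0 <= x <= pi -> cos x = S (2^-1 - w) -> x = al w.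
Proof.
move=> w01 x0 h; have := mellin_angle_itv w01 => aw.
have pi0 := @pi_gt0 R.
rewrite -(@cosK R x) ?in_itv// h -(cos_mellin_angle w01) cosK// in_itv/=.
by apply/andP; split; lra.
Qed.

(** The addition formula is only available for the sine, hence for
    [1/2 - w = (1/2 - 2w) + w]: solving it for the cosine of the angle of
    [2w] gives the duplication formula. *)
Lemma mellin_angle_double w : 0 < w < 4^-1 -> al (2 * w) = 2 * al w.
Proof.
move=> w01; have pi0 := @pi_gt0 R.
have w02 : 0 < w < 2^-1 by lra.
have w03 : 0 < 2 * w < 2^-1 by lra.
have w04 : 0 < 2^-1 - 2 * w < 2^-1 by lra.
have aw := mellin_angle_itv w02.
apply/esym/mellin_angle_eq => //; first by apply/andP; split; lra.
have := mellin_sine_add w04 w02; have := mellin_sine_add w02 w02.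
rewrite (_ : w + w = 2 * w); last by ring.
rewrite (_ : 2^-1 - 2 * w + w = 2^-1 - w); last by field.
rewrite (_ : 2^-1 - (2^-1 - 2 * w) = 2 * w); last by ring.
move=> ->; rewrite (_ : 2 * al w = al w + al w); last by ring.
rewrite cosD.
rewrite -(sin_mellin_angle w02) -(cos_mellin_angle w02).
have c0 : cos (al w) != 0.
  by rewrite (cos_mellin_angle w02) gt_eqF// mellin_sine_gt0//; lra.
move: c0; have := cos2Dsin2 (al w).
move: (cos _) (sin _) (S _) => c s z h c0 e.
apply: (mulIf c0); have e2 : z * c = c - s * (s * c + s * c) by lra.
have h1 : s ^+ 2 = 1 - c ^+ 2 by lra.
rewrite e2; transitivity (c - (s ^+ 2) * c * 2); last by ring.
by transitivity (c * c * c - s ^+ 2 * c); [ring|rewrite h1; ring].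
Qed.

(** The angle of [w] is [2^n] times the angle of [w / 2^n], which is at least
    its sine, for which [mellin_sine_ge] is sharp in the limit. *)
Lemma mellin_angle_ge w : 0 < w < 2^-1 -> pi * w <= al w.
Proof.
move=> w01; have pi0 := @pi_gt0 R.
have key n : pi * w * (1 - w / 2 ^+ n) <= al w.
  have -> : al w = 2 ^+ n * al (w / 2 ^+ n).
    elim: n => [|n ->]; first by rewrite expr0 divr1 mul1r.
    rewrite exprS -mulrA mulrCA; congr (_ * _).
    have p2 : 0 < 2 ^+ n :> R by rewrite exprn_gt0.
    rewrite -mellin_angle_double; first by congr al; field; rewrite gt_eqF.
    have p1 : 1 <= 2 ^+ n :> R by rewrite exprn_ege1// ler1n.
    apply/andP; split; first by rewrite divr_gt0 ?mulr_gt0//; lra.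
    by rewrite ltr_pdivrMr ?mulr_gt0//; nra.
  have p2 : 0 < 2 ^+ n :> R by rewrite exprn_gt0.
  have p1 : 1 <= 2 ^+ n :> R by rewrite exprn_ege1// ler1n.
  have v01 : 0 < w / 2 ^+ n < 2^-1.
    apply/andP; split; first by rewrite divr_gt0//; lra.
    by rewrite ltr_pdivrMr//; nra.
  have /andP[a0 _] := mellin_angle_itv v01.
  apply: (@le_trans _ _ (2 ^+ n * S (w / 2 ^+ n))); last first.
    by rewrite ler_pM2l// -(sin_mellin_angle v01) sin_le_id.
  apply: (@le_trans _ _ (2 ^+ n * (pi * (w / 2 ^+ n) * (1 - w / 2 ^+ n)))); last first.
    by rewrite ler_pM2l//; apply: mellin_sine_ge; lra.
  by rewrite le_eqVlt; apply/orP; left; apply/eqP; field; rewrite gt_eqF.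
(* Otherwise the deficit exceeds [pi w^2 / 2^n] for some [n]. *)
rewrite leNgt; apply/negP => lt.
set e := pi * w - al w; have e0 : 0 < e by rewrite /e; lra.
have := truncnS_gt (pi * w * w / e); set n := (Num.trunc _).+1 => hn.
have := key n; have n2 : n%:R < 2 ^+ n :> R by rewrite -natrX ltr_nat ltn_expl.
have p2 : 0 < 2 ^+ n :> R by rewrite exprn_gt0.
have : pi * w * w / e < 2 ^+ n by apply: lt_trans n2.
rewrite ltr_pdivrMr// -ltr_pdivrMl// => h1 h2.
have h3 : (2 ^+ n)^-1 * (pi * w * w) = pi * w * (w / 2 ^+ n) by rewrite mulrC mulrA.
move: h1 h2; rewrite h3 mulrBr mulr1 /e.
move=> h1 h2; suff : pi * w * (w / 2 ^+ n) < pi * w * (w / 2 ^+ n) by rewrite ltxx.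
by apply: (lt_le_trans h1); rewrite lerBlDr -lerBlDl.
Qed.

(** The lower bound of [mellin_angle_ge] holds at [w] and at [1/2 - w], and the
    two angles add up to [pi/2], so both bounds are equalities. *)
Lemma mellin_sineE w : 0 < w < 1 -> S w = sin (pi * w).
Proof.
have pi0 := @pi_gt0 R.
have lo v : 0 < v < 2^-1 -> S v = sin (pi * v).
  move=> v01; rewrite -sin_mellin_angle//; congr sin.
  have v02 : 0 < 2^-1 - v < 2^-1 by lra.
  have av := mellin_angle_itv v01.
  have : pi / 2 - al v = al (2^-1 - v).
    apply: mellin_angle_eq => //; first by apply/andP; split; lra.
    rewrite (_ : 2^-1 - (2^-1 - v) = v); last by ring.
    by rewrite -(sin_mellin_angle v01) cosB cos_pihalf sin_pihalf; ring.
  have := mellin_angle_ge v01; have := mellin_angle_ge v02.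
  by move: (al v) (al _) => x y h1 h2 h3; apply/eqP; rewrite eq_le; apply/andP; split; lra.
move=> w01; have [w2|w2|->] := ltgtP w 2^-1.
- by apply: lo; lra.
- rewrite /mellin_sine -mellin_inv1D_onem -/(S (1 - w)) lo; last by lra.
  by rewrite mulrBr mulr1 sinB sinpi cospi; ring.
- by rewrite mellin_sine_half sin_pihalf.
Qed.

Lemma mellin_inv1DE w : 0 < w < 1 -> K w = (pi / sin (pi * w))%:E.
Proof.
move=> w01; rewrite (mellin_inv1D_fin w01) -(mellin_sineE w01) /mellin_sine; congr EFin.
by rewrite invf_div mulrCA mulfV ?mulr1// gt_eqF// pi_gt0.
Qed.

Lemma integral_expRD1expR2 (h : R) : 0 < h < 2 ->
  (\int[mu]_y (expR (h * y) / (1 + expR (2 * y)))%:E = (pi / 2 / sin (pi * h / 2))%:E)%E.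
Proof.
move=> h02.
have h01 : 0 < h / 2 < 1 by lra.
pose f x : \bar R := (expR (h / 2 * x) / (1 + expR x))%:E.
have mf : measurable_fun [set: R] f by rewrite /f; meas.
have f0 x : (0 <= f x)%E by rewrite lee_fin ge0_mellin_inv1D.
have := ge0_integral_affine 0 (ltr0n R 2) mf f0.
rewrite -[X in (_ = _ * X)%E -> _]/(K (h / 2)) mellin_inv1DE// -EFinM.
rewrite (_ : 2^-1 * _ = pi / 2 / sin (pi * h / 2)); last by rewrite !mulrA; ring.
move=> <-; apply: eq_integral => y _.
by rewrite /f addr0 (_ : h / 2 * (2 * y) = h * y)//; field.
Qed.

End reflection.

(** * Euler's Gamma and Beta integrals *)

Section gamma_beta.
Context {R : realType}.
Local Notation mu := (@lebesgue_measure R).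
Implicit Types (s x y z v : R).

(** Euler's integral for Gamma in the logarithmic variable. *)
Definition egamma s : \bar R := \int[mu]_y (expR (s * y - expR y))%:E.

(** The Beta integral in the form of the integral of [u^b (1+u)^-(a+b)]
    against [du/u], with [u = expR x]. *)
Definition ebeta (a b : R) : \bar R :=
  \int[mu]_x (expR (b * x - (a + b) * ln (1 + expR x)))%:E.

Lemma egamma_gt0 s : (0 < egamma s)%E.
Proof.
have m : measurable_fun [set: R] (fun y => expR (s * y - expR y)) by meas.
by apply: (integral_gt0 m) => x; exact: expR_gt0.
Qed.

Lemma egamma1 : egamma 1 = 1%E.
Proof.
have := @ge0_integral_FTC R (fun y => expR (1 * y - expR y)) (cst 0)
  (fun y => - expR (- expR y)) 0 (-1).
under [X in (_ = X + _)%E]eq_integral do rewrite /=.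
rewrite integral0 => h.
have : (egamma 1 + (-1)%:E = 0 + 0%:E)%E.
  apply: h.
  - apply: derivable_continuousT => x; exact: ex_derive.
  - by move=> x; exact: cvg_cst.
  - by move=> x; exact: expR_ge0.
  - by [].
  - move=> x; apply: is_derive_eq; rewrite /GRing.scale/= subr0 mul1r expRB expRN; ring.
  - rewrite -[X in _ --> X]oppr0; apply: cvgN.
    by apply: (cvg_comp (@expR R) (fun x => expR (- x))); [exact: cvgy_expR|exact: cvgr_expR].
  - apply: cvgN; rewrite -[X in _ --> X]expR0 -oppr0.
    apply: continuous_cvg; first exact: continuous_expR.
    apply: cvgN.
    have := @cvgNy_expRM R 1 ltr01.
    by under eq_fun do rewrite mul1r.
have := egamma_gt0 1; case: (egamma 1) => //= r _.
by rewrite adde0 -EFinD => -[h1]; congr EFin; lra.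
Qed.

(** Comparison with [mellin_inv1D] at an exponent [w] below both [s] and 1:
    the remaining factor is at most [(1 + u)^n], and [(1 + u)^(n+1)] is
    dominated by the exponential of [u]. *)
Lemma egamma_fin s : 0 < s -> egamma s = (fine (egamma s))%:E.
Proof.
move=> s0; rewrite fineK// ge0_fin_numE ?(ltW (egamma_gt0 s))//.
pose w : R := Num.min s 2^-1.
have w01 : 0 < w < 1.
  by rewrite /w; apply/andP; split; [rewrite lt_min s0/=; lra|rewrite gt_min; apply/orP; right; lra].
have ws : w <= s by rewrite /w ge_min lexx.
pose n := (Num.trunc s).+1.
pose C : R := n.+1`!%:R * expR 1.
have sn : s < n%:R by exact: truncnS_gt.
apply: (@le_lt_trans _ _ (C%:E * mellin_inv1D w)%E); last first.
  by rewrite (mellin_inv1D_fin w01) -EFinM ltry.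
rewrite /mellin_inv1D -integralZlr; last 3 first.
- by rewrite mulr_ge0 ?expR_ge0.
- by meas.
- by move=> x; rewrite ge0_mellin_inv1D.
apply: le_integralr.
- by meas.
- by meas.
- by move=> y; exact: expR_ge0.
move=> y.
have y1 := gt0_1pexpR y.
rewrite mulrA ler_pdivlMr//.
have e1 : expR ((s - w) * y) <= (1 + expR y) ^+ n.
  rewrite mulrC expRM.
  apply: (@le_trans _ _ ((1 + expR y) `^ (s - w))).
    by apply: ge0_ler_powR; rewrite ?nnegrE ?subr_ge0 ?expR_ge0 ?(ltW y1)// lerDr.
  rewrite -powR_mulrn ?(ltW y1)//; apply: ler_powR; first by rewrite lerDl expR_ge0.
  by lra.
have e2 : (1 + expR y) ^+ n.+1 <= C * expR (expR y).
  rewrite /C -mulrA -expRD.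
  have := @expR_ge1Dxn R (1 + expR y) n (ltW y1) => h.
  have : (1 + expR y) ^+ n.+1 / n.+1`!%:R <= expR (1 + expR y) by apply: le_trans h; rewrite lerDr.
  by rewrite ler_pdivrMr ?ltr0n ?fact_gt0// mulrC.
have -> : s * y - expR y = w * y + ((s - w) * y - expR y) by ring.
rewrite expRD [C * _]mulrC -mulrA ler_pM2l ?expR_gt0// expRB.
rewrite mulrAC ler_pdivrMr ?expR_gt0//.
apply: le_trans e2; rewrite exprS mulrC ler_pM2l//.
Qed.

(** The integral of [p^(a-1) q^(b-1) g(p + q)] separates: with [q = p u] one
    has [p + q = p (1 + u)], and for fixed [u] the factor [1 + u] is absorbed
    by a translation of the logarithm of [p]. *)
Lemma ebeta_conv (a b : R) (g : R -> R) :
  measurable_fun [set: R] g -> (forall x, 0 < x -> 0 <= g x) ->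
  (\int[mu]_y \int[mu]_z (expR (a * y + b * z) * g (expR y + expR z))%:E =
   ebeta a b * \int[mu]_v (expR ((a + b) * v) * g (expR v))%:E)%E.
Proof.
move=> mg g0.
pose k v := expR ((a + b) * v) * g (expR v).
have mge d (T : measurableType d) (h : T -> R) : measurable_fun [set: T] h ->
    measurable_fun [set: T] (fun p => g (h p)).
  by move=> mh; exact: (measurableT_comp mg).
have mk : measurable_fun [set: R] k.
  by rewrite /k; apply: measurable_funM; [meas|apply: mge; meas].
have k0 v : 0 <= k v by rewrite mulr_ge0 ?expR_ge0 ?g0 ?expR_gt0.
pose L x : R := ln (1 + expR x).
transitivity (\int[mu]_y \int[mu]_x (expR (b * x - (a + b) * L x) * k (y + L x))%:E)%E.
  apply: eq_integral => y _.
  have m : measurable_fun [set: R] (fun z => expR (a * y + b * z) * g (expR y + expR z)).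
    by apply: measurable_funM; [meas|apply: mge; meas].
  rewrite -(ge0_integral_shift y m); last first.
    by move=> z; rewrite mulr_ge0 ?expR_ge0 ?g0 ?addr_gt0 ?expR_gt0.
  apply: eq_integral => x _; congr EFin.
  rewrite /k mulrA -expRD; congr (expR _ * g _); first by ring.
  by rewrite expRD [RHS]expRD lnK ?posrE ?gt0_1pexpR//; ring.
have mL : measurable_fun [set: R] L by rewrite /L; meas.
rewrite integral_swap; last 2 first.
- apply: measurable_funM.
    by rewrite /L; meas.
  apply: (measurableT_comp mk); apply: measurable_funD; first by meas.
  by apply: (measurableT_comp mL); exact: measurable_snd.
- by move=> x y; rewrite mulr_ge0 ?expR_ge0.
rewrite muleC /ebeta -ge0_integralZl; last 4 first.
- exact: measurableT.
- by meas.
- by move=> x _; rewrite lee_fin expR_ge0.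
- by apply: integral_ge0 => x _; rewrite lee_fin k0.
apply: eq_integral => x _.
rewrite integralZlr ?expR_ge0//.
- by rewrite (ge0_integral_shift (L x) mk k0) muleC.
- by apply: (measurableT_comp mk); exact: measurable_funD.
Qed.

Lemma egamma_mul (a b : R) : (egamma a * egamma b = ebeta a b * egamma (a + b))%E.
Proof.
have me : measurable_fun [set: R] (fun x : R => expR (- x)) by meas.
have := @ebeta_conv a b (fun x => expR (- x)) me (fun x _ => expR_ge0 _).
rewrite (_ : egamma (a + b) = (\int[mu]_v (expR ((a + b) * v) * expR (- expR v))%:E)%E); last first.
  by apply: eq_integral => x _; rewrite -expRD.
move=> <-.
rewrite /egamma -ge0_integralZr; last 4 first.
- exact: measurableT.
- by meas.
- by move=> x _; rewrite lee_fin expR_ge0.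
- exact/ltW/egamma_gt0.
apply: eq_integral => y _.
rewrite /egamma -integralZlr ?expR_ge0//; last by meas.
by apply: eq_integral => z _; rewrite -!expRD; congr (expR _)%:E; ring.
Qed.

Lemma ebeta_fine (a b : R) : 0 < a -> 0 < b ->
  ebeta a b = (fine (egamma a) * fine (egamma b) / fine (egamma (a + b)))%:E.
Proof.
move=> a0 b0; have ab0 : 0 < a + b by rewrite addr_gt0.
have := egamma_mul a b; rewrite (egamma_fin a0) (egamma_fin b0) (egamma_fin ab0).
have : (0 < (fine (egamma (a + b)))%:E)%E by rewrite -egamma_fin ?egamma_gt0.
move: (fine (egamma (a + b))) => c; rewrite lte_fin => c0.
have : (0 <= ebeta a b)%E by apply: integral_ge0 => x _; rewrite lee_fin expR_ge0.
case: (ebeta a b) => [r _||//]; last by move=> _; rewrite gt0_mulye ?lte_fin// -EFinM.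
by rewrite /= -!EFinM => -[->]; congr EFin; rewrite mulfK// gt_eqF.
Qed.

(** The substitution [x = expR y] on the intervals [[exp(-n), exp n]], which
    avoid the point 0 where [f] may be discontinuous. *)
Lemma ge0_integral_expR (f : R -> R) : measurable_fun [set: R] f ->
  (forall x, 0 < x -> {for x, continuous f}) -> (forall x, 0 <= f x) ->
  (\int[mu]_(x in `]0%R, +oo[) (f x)%:E = \int[mu]_y (f (expR y) * expR y)%:E)%E.
Proof.
move=> mf cf f0.
pose h y := f (expR y) * expR y.
have mh : measurable_fun [set: R] h.
  by rewrite /h; apply: measurable_funM; [exact: (measurableT_comp mf)|meas].
have h0 y : 0 <= h y by rewrite mulr_ge0 ?expR_ge0.
have dexp : (@expR R)^`()%classic = expR by apply/funext => x; rewrite derive1E derive_val.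
have cexp : continuous (@expR R) by exact: continuous_expR.
have eqn (n : nat) : (\int[mu]_(x in `[expR (- (n%:R : R)%R), expR (n%:R : R)%R]) (f x)%:E =
    \int[mu]_(x in `[(- (n%:R : R))%R, (n%:R : R)%R]) (h x)%:E)%E.
  have n0 : (0 : R) <= n%:R by [].
  rewrite integration_by_substitution_increasing ?dexp//.
  - by lra.
  - by move=> x y _ _; rewrite ltr_expR.
  - by apply/cvg_ex; exists (expR (- n%:R)); apply: cvg_at_right_filter; exact: cexp.
  - by apply/cvg_ex; exists (expR n%:R); apply: cvg_at_left_filter; exact: cexp.
  - split; first by move=> x _; exact: ex_derive.
      by apply: cvg_at_right_filter; exact: cexp.
    by apply: cvg_at_left_filter; exact: cexp.
  - apply: continuous_in_subspaceT => x; rewrite inE/= in_itv/= => /andP[x0 _].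
    by apply: cf; apply: lt_le_trans x0; exact: expR_gt0.
have mh' : measurable_fun [set: R] (EFin \o h) by exact/measurable_EFinP.
have l1 := @cvgn_integral_itvNn R (EFin \o h) mh' (fun x => h0 x).
have l2 : (\int[mu]_(x in `[expR (- (n%:R : R)%R), expR (n%:R : R)%R]) (f x)%:E @[n --> \oo] -->
    \int[mu]_(x in `]0%R, +oo[) (f x)%:E)%E.
  have -> : `]0%R, +oo[%classic = \bigcup_n `[expR (- (n%:R : R)%R), expR (n%:R : R)%R]%classic.
    apply/seteqP; split => x /=.
      rewrite in_itv/= andbT => x0.
      exists (Num.trunc `|ln x|).+1 => //=.
      have := truncnS_gt `|ln x|; move: (_.+1) => n /ltW; rewrite ler_norml => /andP[h1 h2].
      by rewrite in_itv/= -{1 2}(lnK (_ : x \is Num.pos)) ?posrE// !ler_expR h1.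
    move=> [n _] /=; rewrite !in_itv/= andbT => /andP[h1 _].
    by apply: lt_le_trans h1; exact: expR_gt0.
  apply: ge0_nondecreasing_set_cvg_integral => //.
  - move=> m n mn; apply/subsetPset => x /=; rewrite !in_itv/= => /andP[h1 h2].
    have mn' : (m%:R : R) <= n%:R by rewrite ler_nat.
    apply/andP; split.
      by apply: le_trans h1; rewrite ler_expR lerN2.
    by apply: (le_trans h2); rewrite ler_expR.
  - by move=> n; apply: measurable_funTS; exact/measurable_EFinP.
  - by move=> n x _; rewrite lee_fin.
have {}l1 : (\int[mu]_(x in `[expR (- (n%:R : R)%R), expR (n%:R : R)%R]) (f x)%:E @[n --> \oo] -->
    \int[mu]_y (h y)%:E)%E by under eq_fun do rewrite eqn; exact: l1.
exact: (cvg_unique _ l2 l1).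
Qed.

Lemma Gamma_egamma s : Gamma s = fine (egamma s).
Proof.
rewrite /Gamma /Rintegral; congr fine.
rewrite (ge0_integral_expR (f := fun x => x `^ (s - 1) * expR (- x))).
- apply: eq_integral => y _; congr EFin.
  by rewrite -expRM mulrAC -!expRD; congr expR; ring.
- by meas.
- move=> x x0; apply: cvgM.
    have : {for x, continuous (fun x => x `^ (s - 1))}.
      apply: differentiable_continuous; apply/derivable1_diffP.
      by apply: derivable_powR; rewrite in_itv/= x0.
    exact.
  by apply: (derivable_continuousT (f := fun x => expR (- x))) => y; exact: ex_derive.
- by move=> x; rewrite mulr_ge0 ?powR_ge0 ?expR_ge0.
Qed.

End gamma_beta.

(** * The Poisson semigroup *)

Section poisson.
Context {R : realType}.
Local Notation mu := (@lebesgue_measure R).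
Implicit Types (p q r s t x : R).

Lemma cvgy_inv : (x : R)^-1 @[x --> +oo] --> (0 : R).
Proof.
apply/cvgrPdist_lt => e e0; near=> x.
have x0 : e^-1 < x by near: x; apply: nbhs_pinfty_gt; exact: num_real.
have x1 : 0 < x by apply: lt_trans x0; rewrite invr_gt0.
by rewrite sub0r normrN gtr0_norm ?invr_gt0// -(invrK e) ltf_pV2 ?posrE ?invr_gt0.
Unshelve. all: by end_near. Qed.

Lemma gt0_sqrD p x : 0 < p -> 0 < p ^+ 2 + x ^+ 2.
Proof. by move=> p0; rewrite ltr_pwDl ?exprn_gt0// sqr_ge0. Qed.

Lemma cvgy_xsqrD q : 0 < q -> x / (q ^+ 2 + x ^+ 2) @[x --> +oo] --> (0 : R).
Proof.
move=> q0.
have : (x^-1 / (q ^+ 2 * x^-1 ^+ 2 + 1)) @[x --> +oo] --> (0 : R).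
  rewrite -[X in _ --> X](mul0r (q ^+ 2 * 0 ^+ 2 + 1)^-1).
  apply: cvgM; first exact: cvgy_inv.
  apply: cvgV; first by rewrite expr0n/= mulr0 add0r oner_eq0.
  apply: cvgD; last exact: cvg_cst.
  apply: cvgM; first exact: cvg_cst.
  by rewrite !expr2; apply: cvgM; exact: cvgy_inv.
move=> h; apply: cvg_trans h; apply: near_eq_cvg; near=> x.
have x0 : 0 < x by near: x; apply: nbhs_pinfty_gt; exact: num_real.
have h := gt0_sqrD x q0.
by field; rewrite !gt_eqF// mulr_gt0.
Unshelve. all: by end_near. Qed.

Lemma is_derive_ln_sqrD p r x : 0 < p ->
  is_derive x 1 (fun x => ln (p ^+ 2 + (x - r) ^+ 2))
     (2 * (x - r) / (p ^+ 2 + (x - r) ^+ 2)).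
Proof.
move=> p0; have h := is_derive1_ln (gt0_sqrD (x - r) p0).
by apply: is_derive_eq; rewrite /GRing.scale/=; ring.
Qed.

Lemma is_derive_atan_div p r x : 0 < p ->
  is_derive x 1 (fun x => atan ((x - r) / p)) (p / (p ^+ 2 + (x - r) ^+ 2)).
Proof.
move=> p0; apply: is_derive_eq; rewrite /GRing.scale/=.
have := gt0_sqrD (x - r) p0 => h.
by field; rewrite !gt_eqF.
Qed.

Lemma cvgy_ln_sqrD p q r : 0 < p -> 0 < q ->
  ln (q ^+ 2 + x ^+ 2) - ln (p ^+ 2 + (x - r) ^+ 2) @[x --> +oo] --> (0 : R).
Proof.
move=> p0 q0.
pose G (u : R) : R := (q ^+ 2 * u ^+ 2 + 1) / (p ^+ 2 * u ^+ 2 + (1 - r * u) ^+ 2).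
have G1 : ln (G x^-1) @[x --> +oo] --> (0 : R).
  have e : G 0 = 1 by rewrite /G expr0n/= !mulr0 !add0r subr0 expr1n divr1.
  rewrite -(@ln1 R) -e.
  apply: (cvg_comp (fun x => G x^-1) (@ln R)); last first.
    by apply: continuous_ln; rewrite e.
  apply: continuous_cvg; last exact: cvgy_inv.
  apply: cvgM.
    by apply: (derivable_continuousT (f := fun u => q ^+ 2 * u ^+ 2 + 1)) => y; exact: ex_derive.
  apply: cvgV; first by rewrite expr0n/= !mulr0 add0r subr0 expr1n oner_eq0.
  by apply: (derivable_continuousT (f := fun u => p ^+ 2 * u ^+ 2 + (1 - r * u) ^+ 2)) => y; exact: ex_derive.
apply: cvg_trans G1; apply: near_eq_cvg; near=> x.
have x0 : 0 < x by near: x; apply: nbhs_pinfty_gt; exact: num_real.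
rewrite -ln_div ?posrE ?gt0_sqrD//; congr ln.
have h := gt0_sqrD (x - r) p0.
rewrite /G; field.
by rewrite !gt_eqF//.
Unshelve. all: by end_near. Qed.

Lemma cvgNy_ln_sqrD p q r : 0 < p -> 0 < q ->
  ln (q ^+ 2 + x ^+ 2) - ln (p ^+ 2 + (x - r) ^+ 2) @[x --> -oo] --> (0 : R).
Proof.
move=> p0 q0; apply/cvgNy_compNP.
rewrite [X in X x @[x --> +oo] --> _](_ : _ = (fun x =>
    ln (q ^+ 2 + x ^+ 2) - ln (p ^+ 2 + (x - - r) ^+ 2))); first exact: cvgy_ln_sqrD.
apply/funext => x /=.
by rewrite sqrrN opprK -(sqrrN (- x - r)) opprB opprK [r + x]addrC.
Qed.

Lemma cvgy_atan_div p r : 0 < p -> atan ((x - r) / p) @[x --> +oo] --> (pi / 2 : R).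
Proof.
move=> p0; apply: (cvg_comp (fun x => (x - r) / p) (@atan R)); last exact: cvgy_atan.
by apply: gt0_cvgMly; [rewrite invr_gt0|exact: cvg_addrr].
Qed.

Lemma cvgNy_atan_div p r : 0 < p -> atan ((x - r) / p) @[x --> -oo] --> (- (pi / 2) : R).
Proof.
move=> p0; apply/cvgNy_compNP.
rewrite [X in X x @[x --> +oo] --> _](_ : _ = (fun x => - atan ((x - - r) / p))).
  by apply: cvgN; exact: cvgy_atan_div.
by apply/funext => x /=; rewrite -atanN; congr atan; ring.
Qed.

(** Up to the factor [pi], the Poisson kernel of the upper half plane at
    height [p]. *)
Definition poisson p x : R := p / (p ^+ 2 + x ^+ 2).

Lemma poisson_gt0 p x : 0 < p -> 0 < poisson p x.
Proof. by move=> p0; rewrite divr_gt0// gt0_sqrD. Qed.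

Lemma continuous_poisson p r : 0 < p -> continuous (fun x => poisson p (x - r)).
Proof.
move=> p0 x; apply: cvgM; first exact: cvg_cst.
apply: cvgV; first by rewrite gt_eqF// gt0_sqrD.
by apply: (derivable_continuousT (f := fun x => p ^+ 2 + (x - r) ^+ 2)) => y; exact: ex_derive.
Qed.

(** The integrand is rational, with an explicit primitive made of logarithms
    and arc tangents.  Its four poles are simple except if [r = 0] and
    [p = q], and then the primitive has another form. *)
Let poisson_conv0 p q r : 0 < p -> 0 < q ->
  (\int[mu]_x (poisson p (x - r) * poisson q x)%:E = (pi * poisson (p + q) r)%:E)%E.
Proof.
move=> p0 q0; have pq0 : 0 < p + q by rewrite addr_gt0.
suff [F [dF Fy FNy]] : exists F : R -> R, [/\
    forall x : R, is_derive x 1 F (poisson p (x - r) * poisson q x),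
    F x @[x --> +oo] --> pi * poisson (p + q) r / 2 &
    F x @[x --> -oo] --> - (pi * poisson (p + q) r / 2)].
  have := @ge0_integral_FTC R (fun x => poisson p (x - r) * poisson q x) (cst 0) F
    (pi * poisson (p + q) r / 2) (- (pi * poisson (p + q) r / 2)).
  under [X in (_ = X + _)%E]eq_integral do rewrite /=.
  rewrite integral0 => h.
  have {h} : (\int[mu]_x (poisson p (x - r) * poisson q x)%:E +
    (- (pi * poisson (p + q) r / 2))%:E = 0 + (pi * poisson (p + q) r / 2)%:E)%E.
    apply: h => //.
    - move=> x; apply: cvgM; first exact: continuous_poisson.
      have : continuous (poisson q).
        rewrite (_ : poisson q = (fun x => poisson q (x - 0))); first exact: continuous_poisson.
        by apply/funext => y; rewrite subr0.
      exact.
    - by move=> x; exact: cvg_cst.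
    - by move=> x; rewrite mulr_ge0 ?(ltW (poisson_gt0 _ _)).
    - by move=> x; rewrite subr0.
  case: (integral _ _ _) => //= i; rewrite add0e -EFinD => -[h].
  by congr EFin; lra.
pose D := (r ^+ 2 + (p + q) ^+ 2) * (r ^+ 2 + (p - q) ^+ 2).
have D1 : 0 < r ^+ 2 + (p + q) ^+ 2 by rewrite addrC gt0_sqrD.
have [D0|D0] := eqVneq (r ^+ 2 + (p - q) ^+ 2) 0.
  have [r0 pq] : r = 0 /\ p = q.
    move/eqP: D0; rewrite paddr_eq0 ?sqr_ge0// !sqrf_eq0 subr_eq0.
    by move=> /andP[/eqP -> /eqP ->].
  rewrite {}r0 {}pq {D1 D0 D} in p0 pq0 *.
  exists (fun x => 2^-1 * (x * (q ^+ 2 + x ^+ 2)^-1 + q^-1 * atan ((x - 0) / q))); split.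
  - move=> x; have h1 := gt0_sqrD x q0.
    have h2 : is_derive x 1 (fun x => (q ^+ 2 + x ^+ 2)^-1) (- (q ^+ 2 + x ^+ 2)^-2 * (2 * x)).
      apply: (@is_derive_eq _ _ _ _ _ _ _ _ (is_deriveV _ _)); first by rewrite gt_eqF.
      by rewrite /GRing.scale/=; ring.
    have h3 := is_derive_atan_div 0 x q0.
    apply: is_derive_eq; rewrite /GRing.scale/= /poisson !subr0.
    by field; rewrite !gt_eqF.
  - have -> : pi * poisson (q + q) 0 / 2 = 2^-1 * (0 + q^-1 * (pi / 2)) :> R.
      by rewrite /poisson; field; rewrite !gt_eqF.
    apply: cvgM; first exact: cvg_cst.
    apply: cvgD; last by apply: cvgM; [exact: cvg_cst|exact: cvgy_atan_div].
    exact: cvgy_xsqrD.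
  - have -> : - (pi * poisson (q + q) 0 / 2) = 2^-1 * (- 0 + q^-1 * - (pi / 2)) :> R.
      by rewrite /poisson; field; rewrite !gt_eqF.
    apply: cvgM; first exact: cvg_cst.
    apply: cvgD; last by apply: cvgM; [exact: cvg_cst|exact: cvgNy_atan_div].
    apply/cvgNy_compNP.
    rewrite [X in X x @[x --> +oo] --> _](_ : _ = (fun x => - (x / (q ^+ 2 + x ^+ 2)))).
      by apply: cvgN; exact: cvgy_xsqrD.
    by apply/funext => x /=; rewrite sqrrN mulNr.
have {}D0 : 0 < r ^+ 2 + (p - q) ^+ 2 by rewrite lt_neqAle eq_sym D0 addr_ge0 ?sqr_ge0.
(* Coefficients of the partial fraction decomposition; the logarithms enter
   through their difference because the integrand is [O(x^-4)], and the sum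
   of the residues is 0. *)
pose A := p * q * r / D; pose B := p * (r ^+ 2 + p ^+ 2 - q ^+ 2) / D.
pose C := q * (r ^+ 2 - p ^+ 2 + q ^+ 2) / D.
exists (fun x => A * (ln (q ^+ 2 + (x - 0) ^+ 2) - ln (p ^+ 2 + (x - r) ^+ 2)) +
  (B * atan ((x - 0) / q) + C * atan ((x - r) / p))); split.
- move=> x; have h1 := gt0_sqrD x q0; have h2 := gt0_sqrD (x - r) p0.
  have d1 := is_derive_ln_sqrD 0 x q0; have d2 := is_derive_ln_sqrD r x p0.
  have d3 := is_derive_atan_div 0 x q0; have d4 := is_derive_atan_div r x p0.
  apply: is_derive_eq; rewrite /GRing.scale/= /poisson !subr0 /A /B /C /D.
  field.
  by rewrite !gt_eqF.
- have -> : pi * poisson (p + q) r / 2 = A * 0 + (B * (pi / 2) + C * (pi / 2)) :> R.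
    by rewrite /poisson /A /B /C /D; field; rewrite !gt_eqF// addrC.
  apply: cvgD; last apply: cvgD; apply: cvgM; try exact: cvg_cst; try exact: cvgy_atan_div.
  under eq_fun do rewrite subr0; exact: cvgy_ln_sqrD.
- have -> : - (pi * poisson (p + q) r / 2) = A * 0 + (B * - (pi / 2) + C * - (pi / 2)) :> R.
    by rewrite /poisson /A /B /C /D; field; rewrite !gt_eqF// addrC.
  apply: cvgD; last apply: cvgD; apply: cvgM; try exact: cvg_cst; try exact: cvgNy_atan_div.
  under eq_fun do rewrite subr0; exact: cvgNy_ln_sqrD.
Qed.

(** The semigroup property: the harmonic extension to height [p] followed by
    that to height [q] is the one to height [p + q]. *)
Lemma poisson_conv p q s t : 0 < p -> 0 < q ->
  (\int[mu]_x (poisson p (t - x) * poisson q (s - x))%:E =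
   (pi * poisson (p + q) (t - s))%:E)%E.
Proof.
move=> p0 q0; rewrite -poisson_conv0//.
have m : measurable_fun [set: R] (fun x => poisson p (t - x) * poisson q (s - x)).
  by rewrite /poisson; meas.
rewrite -(ge0_integral_shift s m); last first.
  by move=> x; rewrite mulr_ge0 ?(ltW (poisson_gt0 _ _)).
apply: eq_integral => x _; rewrite /poisson; congr (_ / (_ + _) * (_ / (_ + _)))%:E; ring.
Qed.

End poisson.

(** * The kernels as superpositions of Poisson kernels *)

Section kernel_repr.
Context {R : realType}.
Local Notation mu := (@lebesgue_measure R).
Implicit Types (a p q r s t x y A B : R).

(** The one-parameter family of which the kernels are the increments.  The
    logarithm fills the gap at [a = 0], where the power is constant. *)
Definition riesz a A : R := if a == 0 then - ln A else A `^ a.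

(** Chosen so that the quotient of an increment of [riesz a] by this constant
    is continuous at [a = 0]: as [a] tends to 0, [A^a - B^a] is equivalent to
    [a (ln A - ln B)] and the sine expression to [- a]. *)
Definition riesz_cst a : R := if a == 0 then 1 else - (2 / pi) * sin (pi * a / 2).

(** The contribution [p^a P_p(A) dp] of the height [p = expR y]: the measure
    [dp] accounts for the exponent [a + 1]. *)
Definition layer a A y : R := expR ((a + 1) * y) * poisson (expR y) A.

Lemma layer_ge0 a A y : 0 <= layer a A y.
Proof. by rewrite mulr_ge0 ?expR_ge0// ltW// poisson_gt0// expR_gt0. Qed.

Lemma measurable_layer a A : measurable_fun [set: R] (layer a A).
Proof. by rewrite /layer /poisson; meas. Qed.

Lemma sin_half_neq0 a : -1 < a < 1 -> a != 0 -> sin (pi * a / 2) != 0.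
Proof.
move=> a1 a0; have pi0 := @pi_gt0 R.
have [a2|a2|/eqP] := ltgtP a 0; last by rewrite (negbTE a0).
  rewrite -oppr_eq0 -sinN gt_eqF// sin_gt0_pi//; apply/andP; split; nra.
by rewrite gt_eqF// sin_gt0_pi//; apply/andP; split; nra.
Qed.

Lemma riesz_cst_neq0 a : -1 < a < 1 -> riesz_cst a != 0.
Proof.
move=> a1; rewrite /riesz_cst; case: (eqVneq a 0) => [_|a0]; first exact: oner_neq0.
by rewrite mulf_neq0// ?sin_half_neq0// oppr_eq0 mulf_neq0// invr_eq0 gt_eqF// pi_gt0.
Qed.

Lemma expR2 y : expR (2 * y) = expR y ^+ 2.
Proof. by rewrite -expRM_natl. Qed.

(** Scaling by [A] leaves the integral of [p^(a+1) / (1 + p^2)] against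
    [dp]. *)
Lemma integral_layer a A : -2 < a < 0 -> 0 < A ->
  (\int[mu]_y (layer a A y)%:E = (A `^ a * (pi / 2 / sin (pi * (a + 2) / 2)))%:E)%E.
Proof.
move=> a0 A0.
rewrite EFinM -integral_expRD1expR2; last lra.
rewrite -integralZlr ?powR_ge0//; last by meas.
rewrite -(ge0_integral_shift (ln A) (measurable_layer a A) (layer_ge0 a A)).
apply: eq_integral => y _; congr EFin; rewrite /layer /poisson.
rewrite (_ : A `^ a = expR (a * ln A)); last by rewrite -{1}(lnK (_ : A \is Num.pos)) ?posrE// -expRM mulrC.
have -> : (a + 1) * (y + ln A) = (a + 2) * y - y + (a * ln A + ln A) by ring.
rewrite expR2 !expRD expRN lnK ?posrE//.
have := expR_gt0 y; move: (expR y) => Y Y0.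
by field; rewrite !gt_eqF// addr_gt0 ?exprn_gt0// mulr_gt0.
Qed.

(** This is [expR (a * y) - layer a A y].  For [0 < a] the layers are not
    integrable at infinity, but these complements are integrable on the whole
    line, and their differences are those of the layers up to sign. *)
Definition colayer a A y : R := expR (a * y) * (A ^+ 2 / (expR y ^+ 2 + A ^+ 2)).

Lemma integral_colayer a A : 0 < a < 2 -> 0 < A ->
  (\int[mu]_y (colayer a A y)%:E = (A `^ a * (pi / 2 / sin (pi * a / 2)))%:E)%E.
Proof.
move=> a0 A0.
have c0 y : 0 <= colayer a A y.
  by rewrite mulr_ge0 ?expR_ge0// divr_ge0 ?addr_ge0 ?sqr_ge0.
have mc : measurable_fun [set: R] (colayer a A) by rewrite /colayer; meas.
rewrite EFinM -integral_expRD1expR2; last lra.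
rewrite -integralZlr ?powR_ge0//; last by meas.
rewrite -(ge0_integral_shift (ln A) mc c0).
apply: eq_integral => y _; congr EFin; rewrite /colayer.
rewrite (_ : A `^ a = expR (a * ln A)); last by rewrite -{1}(lnK (_ : A \is Num.pos)) ?posrE// -expRM mulrC.
rewrite mulrDr expR2 !expRD lnK ?posrE//.
have := expR_gt0 y; move: (expR y) => Y Y0.
by field; rewrite !gt_eqF// addr_gt0 ?exprn_gt0// mulr_gt0.
Qed.

Definition dlayer a A B y : R := layer a A y - layer a B y.

(** That the sign does not depend on [y] is what justifies the exchange of
    integrals in [integral_dlayer_prod]. *)
Lemma dlayer_ge0 a A B y : `|A| <= `|B| -> 0 <= dlayer a A B y.
Proof.
move=> AB; rewrite subr_ge0 ler_wpM2l ?expR_ge0// /poisson.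
rewrite ler_wpM2l ?expR_ge0// lef_pV2 ?posrE ?gt0_sqrD ?expR_gt0//.
by rewrite lerD2l -(real_normK (num_real A)) -(real_normK (num_real B)) ler_sqr ?nnegrE.
Qed.

(** At [a = 0] the primitive is elementary.  For [a < 0] both layers are
    integrable, for [0 < a] their complements are; the change of sign
    between the two cases is that of [sin (x + pi) = - sin x]. *)
Let ge0_integral_dlayer a A B : -1 < a < 1 -> 0 < A -> A <= B ->
  (\int[mu]_y (dlayer a A B y)%:E = ((riesz a A - riesz a B) / riesz_cst a)%:E)%E.
Proof.
move=> a1 A0 AB; have B0 : 0 < B by apply: lt_le_trans AB.
have ml := @measurable_layer a; have l0 := @layer_ge0 a.
have md : measurable_fun [set: R] (dlayer a A B) by apply: measurable_funB.
have d0 y : 0 <= dlayer a A B y by apply: dlayer_ge0; rewrite !gtr0_norm.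
have pi0 := @pi_gt0 R.
rewrite /riesz /riesz_cst; case: (eqVneq a 0) => [a0|a0].
  rewrite {}a0 in ml l0 md d0 *.
  pose F y : R := 2^-1 * (ln (A ^+ 2 + (expR y - 0) ^+ 2) - ln (B ^+ 2 + (expR y - 0) ^+ 2)).
  have := @ge0_integral_FTC R (dlayer 0 A B) (cst 0) F 0 (ln A - ln B).
  under [X in (_ = X + _)%E]eq_integral do rewrite /=.
  rewrite integral0 => h.
  have {h} : (\int[mu]_y (dlayer 0 A B y)%:E + (ln A - ln B)%:E = 0 + 0%:E)%E.
    have dA (C : R) y : 0 < C -> is_derive y 1 (fun y => ln (C ^+ 2 + (expR y - 0) ^+ 2))
        (2 * (expR y - 0) / (C ^+ 2 + (expR y - 0) ^+ 2) * expR y).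
      move=> C0; have h1 := is_derive_ln_sqrD 0 (expR y) C0.
      by apply: (is_derive1_comp h1).
    apply: h => //.
    - move=> y.
      have cl (C : R) : 0 < C -> {for y, continuous (layer 0 C)}.
        move=> C0; apply: cvgM.
          by apply: (derivable_continuousT (f := fun y => expR ((0 + 1) * y))) => z; exact: ex_derive.
        apply: cvgM; first exact: continuous_expR.
        apply: cvgV; first by rewrite gt_eqF// gt0_sqrD// expR_gt0.
        by apply: (derivable_continuousT (f := fun y => expR y ^+ 2 + C ^+ 2)) => z; exact: ex_derive.
      by apply: cvgB; exact: cl.
    - by move=> y; exact: cvg_cst.
    - move=> y; have d1 := dA A y A0; have d2 := dA B y B0.
      apply: is_derive_eq; rewrite /GRing.scale/= !subr0 /dlayer /layer /poisson add0r mul1r.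
      have := expR_gt0 y; move: (expR y) => Y Y0.
      have h1 := gt0_sqrD Y A0; have h2 := gt0_sqrD Y B0.
      by field; rewrite !gt_eqF// addrC.
    - rewrite -(mulr0 2^-1); apply: cvgM; first exact: cvg_cst.
      apply: (cvg_comp (@expR R) (fun x => ln (A ^+ 2 + (x - 0) ^+ 2) - ln (B ^+ 2 + (x - 0) ^+ 2))); first exact: cvgy_expR.
      rewrite [X in X x @[x --> +oo] --> _](_ : _ = (fun x =>
        ln (A ^+ 2 + x ^+ 2) - ln (B ^+ 2 + (x - 0) ^+ 2))); first exact: cvgy_ln_sqrD.
      by apply/funext => x; rewrite subr0.
    - have -> : ln A - ln B = 2^-1 * (ln (A ^+ 2 + (0 - 0) ^+ 2) - ln (B ^+ 2 + (0 - 0) ^+ 2)).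
        by rewrite subr0 expr0n/= !addr0 !lnXn// !mulr2n; field.
      have e0 : expR y @[y --> -oo] --> (0 : R).
        by have := @cvgNy_expRM R 1 ltr01; under eq_fun do rewrite mul1r.
      have cl (C : R) : 0 < C -> ln (C ^+ 2 + (expR y - 0) ^+ 2) @[y --> -oo] --> ln (C ^+ 2 + (0 - 0) ^+ 2).
        move=> C0; apply: (cvg_comp (@expR R) (fun x => ln (C ^+ 2 + (x - 0) ^+ 2)) e0).
        apply: (derivable_continuousT (f := fun x => ln (C ^+ 2 + (x - 0) ^+ 2))) => z.
        by have h := is_derive_ln_sqrD 0 z C0; exact: ex_derive.
      by apply: cvgM; [exact: cvg_cst|apply: cvgB; exact: cl].
  case: (integral _ _ _) => //= i; rewrite !adde0 -EFinD => -[h].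
  by congr EFin; lra.
have s0 := sin_half_neq0 a1 a0.
have alg (c S u v : R) : c != 0 -> S != 0 ->
    u * (c / 2 / - S) - v * (c / 2 / - S) = (u - v) / (- (2 / c) * S).
  by move=> c0 S0; field; rewrite ?c0 ?S0.
have pn : (pi : R) != 0 by rewrite gt_eqF.
have [an|ap|/eqP] := ltgtP a 0; last by rewrite (negbTE a0).
  have := @ge0_integral_lin _ _ _ mu 1 1 (dlayer a A B) (layer a B) (layer a A) ler01 ler01 md (ml B) d0 (l0 B).
  have e y : layer a A y = 1 * dlayer a A B y + 1 * layer a B y by rewrite /dlayer; ring.
  move=> /(_ e); rewrite !mul1e !integral_layer//; [|lra|lra].
  have -> : sin (pi * (a + 2) / 2) = - sin (pi * a / 2).
    by rewrite (_ : pi * (a + 2) / 2 = pi * a / 2 + pi); [rewrite sinDpi|field].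
  case: (integral _ _ _) => //= i; rewrite -EFinD => -[h]; congr EFin.
  have {h} -> : i = A `^ a * (pi / 2 / - sin (pi * a / 2)) - B `^ a * (pi / 2 / - sin (pi * a / 2)) by lra.
  exact: alg.
have mc C : measurable_fun [set: R] (colayer a C) by rewrite /colayer; meas.
have c0 C y : 0 <= colayer a C y.
  by rewrite mulr_ge0 ?expR_ge0// divr_ge0 ?addr_ge0 ?sqr_ge0.
have := @ge0_integral_lin _ _ _ mu 1 1 (dlayer a A B) (colayer a A) (colayer a B) ler01 ler01 md (mc A) d0 (c0 A).
have e y : colayer a B y = 1 * dlayer a A B y + 1 * colayer a A y.
  rewrite /dlayer /colayer /layer /poisson (_ : expR ((a + 1) * y) = expR (a * y) * expR y); last first.
    by rewrite -expRD mulrDl mul1r.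
  have := expR_gt0 y; move: (expR y) => Y Y0.
  have h1 := gt0_sqrD A Y0; have h2 := gt0_sqrD B Y0.
  by field; rewrite !gt_eqF.
move=> /(_ e); rewrite !mul1e !integral_colayer//; [|lra|lra].
case: (integral _ _ _) => //= i; rewrite -EFinD => -[h]; congr EFin.
have {h} -> : i = B `^ a * (pi / 2 / sin (pi * a / 2)) - A `^ a * (pi / 2 / sin (pi * a / 2)) by lra.
have alg2 (c S u v : R) : c != 0 -> S != 0 ->
    v * (c / 2 / S) - u * (c / 2 / S) = (u - v) / (- (2 / c) * S).
  by move=> cn S0; field; rewrite ?cn ?S0.
exact: alg2.
Qed.

(** The second part computes the integral of the absolute value: the sign of
    the integrand is constant, so both integrals agree up to sign. *)
Lemma integral_dlayer a A B : -1 < a < 1 -> A != 0 -> B != 0 ->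
  (\int[mu]_y (dlayer a A B y)%:E =
     ((riesz a `|A| - riesz a `|B|) / riesz_cst a)%:E)%E /\
  (\int[mu]_y `|dlayer a A B y|%:E =
     `|(riesz a `|A| - riesz a `|B|) / riesz_cst a|%:E)%E.
Proof.
move=> a1 A0 B0.
have nE y : dlayer a A B y = dlayer a `|A| `|B| y.
  by rewrite /dlayer /layer /poisson !real_normK ?num_real.
have key A' B' : A' != 0 -> `|A'| <= `|B'| ->
    (\int[mu]_y (dlayer a `|A'| `|B'| y)%:E =
      ((riesz a `|A'| - riesz a `|B'|) / riesz_cst a)%:E)%E /\
    (\int[mu]_y `|dlayer a `|A'| `|B'| y|%:E =
     `|(riesz a `|A'| - riesz a `|B'|) / riesz_cst a|%:E)%E.
  move=> A'0 AB; rewrite -normr_gt0 in A'0.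
  have e := ge0_integral_dlayer a1 A'0 AB.
  have d0 y : 0 <= dlayer a `|A'| `|B'| y by rewrite dlayer_ge0// !normr_id.
  split => //.
  have c0 : 0 <= (riesz a `|A'| - riesz a `|B'|) / riesz_cst a.
    by rewrite -lee_fin -e; apply: integral_ge0 => y _; rewrite lee_fin.
  rewrite (ger0_norm c0) -e.
  by apply: eq_integral => y _; rewrite ger0_norm.
have [AB|BA] := leP `|A| `|B|.
  have [e1 e2] := key _ _ A0 AB.
  by split; [rewrite -e1|rewrite -e2]; apply: eq_integral => y _; rewrite nE.
have [e1 e2] := key _ _ B0 (ltW BA).
have sw y : dlayer a A B y = - dlayer a `|B| `|A| y by rewrite nE opprB.
split; last first.
  rewrite -opprB mulNr normrN -e2.
  by apply: eq_integral => y _; rewrite sw normrN.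
rewrite -opprB mulNr EFinN -e1 -integral_ge0N.
- by apply: eq_integral => y _; rewrite sw EFinN.
- by move=> y _; rewrite lee_fin dlayer_ge0// !normr_id ltW.
Qed.

Lemma fbm_kernelE (H t x : R) : t - x != 0 -> x != 0 ->
  fbm_kernel H t x = riesz (H - 2^-1) `|t - x| - riesz (H - 2^-1) `|x|.
Proof.
move=> tx0 x0; rewrite /fbm_kernel /riesz subr_eq0; case: eqP => // _.
by rewrite !div1r !lnV ?posrE ?normr_gt0.
Qed.

End kernel_repr.

(** * The covariance of the kernels *)

Section covariance_integral.
Context {R : realType}.
Local Notation mu := (@lebesgue_measure R).
Local Notation mu2 := (@lebesgue2 R).
Local Notation RR := (measurableTypeR R).
Implicit Types (a b p q r s t x y z : R).

(** The weight [p^a q^b dp dq] of a pair of heights, in logarithmic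
    variables. *)
Definition wpair a b (w : R * R) : R := expR ((a + 1) * w.1) * expR ((b + 1) * w.2).

Definition pois2 u v (w : R * R) x : R :=
  poisson (expR w.1) (u - x) * poisson (expR w.2) (v - x).

(** Half the integral over [x] of [dlayer a (r - x) x * dlayer b (r - x) x] at
    the pair of heights [w]. *)
Definition bump a b r (w : R * R) : R :=
  wpair a b w * (pi * (poisson (expR w.1 + expR w.2) 0 - poisson (expR w.1 + expR w.2) r)).

Definition cov_cst a b : R :=
  pi * (Gamma (a + 1) * Gamma (b + 1) / Gamma (a + b + 2)) *
  (pi / 2 / sin (pi * (a + b + 1) / 2)).

Lemma wpair_ge0 a b w : 0 <= wpair a b w.
Proof. by rewrite mulr_ge0 ?expR_ge0. Qed.

Lemma pois2_ge0 u v w x : 0 <= pois2 u v w x.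
Proof. by rewrite mulr_ge0// ltW// poisson_gt0// expR_gt0. Qed.

Lemma poisson_le0 p r : 0 < p -> poisson p r <= poisson p 0.
Proof.
move=> p0; rewrite /poisson ler_wpM2l ?(ltW p0)// lef_pV2 ?posrE ?gt0_sqrD//.
by rewrite expr0n/= addr0 lerDl sqr_ge0.
Qed.

Lemma bump_ge0 a b r w : 0 <= bump a b r w.
Proof.
rewrite mulr_ge0 ?wpair_ge0// mulr_ge0 ?pi_ge0// subr_ge0 poisson_le0//.
by rewrite addr_gt0 ?expR_gt0.
Qed.

Lemma measurable_bump a b r : measurable_fun [set: R * R] (bump a b r).
Proof. by rewrite /bump /wpair /poisson; meas. Qed.

(** The function of [p + q] in the bump is [pi r^2 / (u (u^2 + r^2))] at
    [u = p + q]; [ebeta_conv] and [integral_colayer] do the rest. *)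
Lemma integral_bump a b r : -1 < a -> -1 < b -> -1 < a + b < 1 ->
  (\int[mu2]_w (bump a b r w)%:E = (cov_cst a b * `|r| `^ (a + b + 1))%:E)%E.
Proof.
move=> a1 b1 ab.
rewrite fubini_tonelli1; last 2 first.
- by apply/measurable_EFinP; exact: measurable_bump.
- by move=> w; rewrite lee_fin bump_ge0.
pose g u : R := pi * (poisson u 0 - poisson u r).
have mg : measurable_fun [set: R] g by rewrite /g /poisson; meas.
have g0 u : 0 < u -> 0 <= g u.
  by move=> u0; rewrite mulr_ge0 ?pi_ge0// subr_ge0 poisson_le0.
have pi0 := @pi_gt0 R.
have a1' : 0 < a + 1 by lra.
have b1' : 0 < b + 1 by lra.
transitivity (\int[mu]_y \int[mu]_z (expR ((a + 1) * y + (b + 1) * z) * g (expR y + expR z))%:E)%E.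
  apply: eq_integral => y _; apply: eq_integral => z _.
  by rewrite /bump /wpair /= -expRD.
rewrite ebeta_conv// ebeta_fine//.
have -> : (\int[mu]_v (expR ((a + 1 + (b + 1)) * v) * g (expR v))%:E =
    (pi * (`|r| `^ (a + b + 1) * (pi / 2 / sin (pi * (a + b + 1) / 2))))%:E)%E.
  have e v : expR ((a + 1 + (b + 1)) * v) * g (expR v) = pi * colayer (a + b + 1) `|r| v.
    rewrite /colayer /g /poisson real_normK ?num_real//.
    rewrite (_ : (a + 1 + (b + 1)) * v = (a + b + 1) * v + v); last by ring.
    rewrite expRD; have := expR_gt0 v; move: (expR v) => Y Y0.
    have h := gt0_sqrD r Y0.
    by rewrite expr0n/= addr0; field; rewrite !gt_eqF.
  under eq_integral do rewrite e.
  have [r0|r0] := eqVneq r 0.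
    rewrite r0 normr0 powR0; last by apply/eqP; lra.
    rewrite mul0r mulr0 integral0_eq// => v _.
    by rewrite /colayer expr0n/= mul0r mulr0 mulr0.
  rewrite integralZlr ?pi_ge0//.
  - by rewrite integral_colayer ?normr_gt0//; lra.
  - by rewrite /colayer; meas.
  - by move=> v; rewrite mulr_ge0 ?expR_ge0// divr_ge0 ?addr_ge0 ?sqr_ge0.
rewrite -EFinM; congr EFin; rewrite /cov_cst !Gamma_egamma.
rewrite (_ : a + 1 + (b + 1) = a + b + 2); last by ring.
by rewrite [_ * (pi / 2 / _)]mulrC !mulrA; ring.
Qed.

(** Expanding the product gives four convolutions of Poisson kernels.  They
    are grouped as a difference of two nonnegative functions, and the result
    is regrouped around the value at 0. *)
Lemma integral_dlayer2 a b t s (w : R * R) :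
  (\int[mu]_x (dlayer a (t - x) x w.1 * dlayer b (s - x) x w.2)%:E =
   (bump a b t w + bump a b s w - bump a b (t - s) w)%:E)%E.
Proof.
have p0 := expR_gt0 w.1; have q0 := expR_gt0 w.2.
have mP u v : measurable_fun [set: R] (pois2 u v w) by rewrite /pois2 /poisson; meas.
have iP u v : (\int[mu]_x (pois2 u v w x)%:E = (pi * poisson (expR w.1 + expR w.2) (u - v))%:E)%E.
  exact: poisson_conv.
pose E := wpair a b w; have E0 : 0 <= E by exact: wpair_ge0.
pose F u v u' v' x : R := E * pois2 u v w x + E * pois2 u' v' w x.
have F0 u v u' v' x : 0 <= F u v u' v' x.
  by apply: addr_ge0; apply: mulr_ge0 => //; exact: pois2_ge0.
have mF u v u' v' : measurable_fun [set: R] (F u v u' v').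
  by apply: measurable_funD; apply: measurable_funM => //; exact: mP.
have iF u v u' v' := @ge0_integral_lin _ _ _ mu E E (pois2 u v w) (pois2 u' v' w)
  (F u v u' v') E0 E0 (mP u v) (mP u' v') (pois2_ge0 u v w) (pois2_ge0 u' v' w) (fun _ => erefl).
under eq_integral => x _.
  rewrite (_ : _ * _ = F t s 0 0 x - F t 0 0 s x); last first.
    rewrite /F /E /wpair /pois2 /dlayer /layer.
    have N c : poisson c (0 - x) = poisson c x by rewrite sub0r /poisson sqrrN.
    by rewrite !N; ring.
  over.
have := integral_subr (nu := mu) (mF t s 0 0) (mF t 0 0 s) (F0 t s 0 0) (F0 t 0 0 s).
rewrite !iF !iP -!EFinM -!EFinD => /(_ _ _ erefl erefl) ->.
congr EFin; rewrite /bump -/E !subr0 sub0r.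
have N c x : poisson c (- x) = poisson c x by rewrite /poisson sqrrN.
by rewrite N; ring.
Qed.

(** Fubini on the line times the plane of the two heights.  The sections at
    fixed [x] are tensor products of functions of constant sign, so the
    integral of the absolute value over the heights is the absolute value of
    the product of the kernels, up to a constant. *)
Lemma integral_dlayer_prod a b t s :
  -1 < a < 1 -> -1 < b < 1 -> -1 < a + b < 1 ->
  (\int[mu]_x (`|(riesz a `|t - x|%R - riesz a `|x|%R) * (riesz b `|s - x|%R - riesz b `|x|%R)|%R)%:E < +oo)%E ->
  (\int[mu]_x ((riesz a `|t - x|%R - riesz a `|x|%R) / riesz_cst a *
     ((riesz b `|s - x|%R - riesz b `|x|%R) / riesz_cst b))%:E =
   (cov_cst a b * (`|t| `^ (a + b + 1) + `|s| `^ (a + b + 1) - `|t - s| `^ (a + b + 1)))%:E)%E.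
Proof.
move=> a1 b1 ab fin.
pose ka x := (riesz a `|t - x| - riesz a `|x|) / riesz_cst a.
pose kb x := (riesz b `|s - x| - riesz b `|x|) / riesz_cst b.
have mr c u : measurable_fun [set: R] (fun x : R => riesz c `|u - x|).
  by rewrite /riesz; case: (c == 0); meas.
have mr0 c : measurable_fun [set: R] (fun x : R => riesz c `|x|).
  by rewrite /riesz; case: (c == 0); meas.
have mka : measurable_fun [set: R] ka.
  by apply: measurable_funM => //; exact: measurable_funB.
have mkb : measurable_fun [set: R] kb.
  by apply: measurable_funM => //; exact: measurable_funB.
pose G (w : RR * (RR * RR)) : R := dlayer a (t - w.1) w.1 w.2.1 * dlayer b (s - w.1) w.1 w.2.2.
have mG : measurable_fun [set: RR * (RR * RR)] G.
  by rewrite /G /dlayer /layer /poisson; meas.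
pose N : set R := [set 0; t; s]%classic.
have cN : countable N by apply: finite_set_countable; rewrite /N; exact: finite_set3.
have ten x : ~ N x ->
    (\int[mu2]_w `|G (x, w)|%:E = `|ka x * kb x|%:E)%E /\
    (\int[mu2]_w (G (x, w))%:E = (ka x * kb x)%:E)%E.
  move=> Nx.
  have x0 : x != 0 by apply/eqP => e; apply: Nx; left; left.
  have tx0 : t - x != 0 by rewrite subr_eq0; apply/eqP => e; apply: Nx; left; right.
  have sx0 : s - x != 0 by rewrite subr_eq0; apply/eqP => e; apply: Nx; right.
  have [fa fA] := integral_dlayer a1 tx0 x0.
  have [gb gB] := integral_dlayer b1 sx0 x0.
  have mf c u v : measurable_fun [set: R] (dlayer c u v).
    by rewrite /dlayer /layer /poisson; meas.
  by have := integral_tensor (mf _ _ _) (mf _ _ _) fA gB fa gb; rewrite -normrM.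
have mGx x : measurable_fun [set: R * R] (fun w => G (x, w)).
  by rewrite /G /dlayer /layer /poisson /=; meas.
have mGE : measurable_fun [set: RR * (RR * RR)] (EFin \o G) by exact/measurable_EFinP.
have : (\int[mu]_x \int[mu2]_w `|(EFin \o G) (x, w)| < +oo)%E.
  apply: le_lt_trans (_ : (\int[mu]_x `|ka x * kb x|%:E < +oo)%E).
    rewrite le_eqVlt; apply/orP; left; apply/eqP.
    apply: (eq_integral_countable cN).
    - apply: (@measurable_fun_fubini_tonelli_F _ _ _ _ R mu2 (abse \o (EFin \o G))).
        exact: measurableT_comp.
      by move=> w; exact: abse_ge0.
    - by apply/measurable_EFinP; apply: measurableT_comp => //; exact: measurable_funM.
    - by move=> x Nx; rewrite -(ten x Nx).1.
  have e x : `|ka x * kb x| = `|(riesz_cst a * riesz_cst b)^-1| *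
     `|(riesz a `|t - x| - riesz a `|x|) * (riesz b `|s - x| - riesz b `|x|)|.
    by rewrite -normrM /ka /kb invfM; congr `|_|; ring.
  under eq_integral do rewrite e.
  rewrite integralZlr//; first exact: lte_mul_pinfty.
  by apply: measurableT_comp => //; apply: measurable_funM; apply: measurable_funB; [exact: mr|exact: mr0|exact: mr|exact: mr0].
move=> /(@integrable12ltyP _ _ _ _ R mu mu2 (EFin \o G) mGE).2 iG.
transitivity (\int[mu]_x \int[mu2]_w (G (x, w))%:E)%E.
  apply: (eq_integral_countable cN).
  - by apply/measurable_EFinP; exact: measurable_funM.
  - exact: (measurable_int _ (integrable_fubini_F iG)).
  - by move=> x Nx; rewrite (ten x Nx).2.
rewrite (Fubini iG) /=.
under eq_integral => w _ do rewrite /G /= integral_dlayer2.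
have := @ge0_integral_lin _ _ _ mu2 1 1 (bump a b t) (bump a b s)
  (fun w => bump a b t w + bump a b s w) ler01 ler01 (measurable_bump a b t)
  (measurable_bump a b s) (bump_ge0 a b t) (bump_ge0 a b s).
move=> /(_ _)h.
have {h} := h (fun w => esym (congr2 +%R (mul1r _) (mul1r _))).
rewrite !mul1e !integral_bump//; [|lra|lra|lra|lra].
rewrite -EFinD => h.
have mV : measurable_fun [set: R * R] (fun w => bump a b t w + bump a b s w).
  by apply: measurable_funD; exact: measurable_bump.
have V0 w : 0 <= bump a b t w + bump a b s w by rewrite addr_ge0 ?bump_ge0.
rewrite (integral_subr (nu := mu2) mV (measurable_bump a b (t - s)) V0 (bump_ge0 _ _ _) h (integral_bump (t - s) _ _ _))//; [|lra|lra].
by congr EFin; ring.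
Qed.

End covariance_integral.

(** * Square-integrable functions *)

Section square_integrable.
Context d (T : measurableType d) {R : realType} (nu : {measure set T -> \bar R}).
Implicit Types f g h : T -> R.

Definition sqint f := measurable_fun [set: T] f /\
  nu.-integrable [set: T] (fun x => (f x ^+ 2)%:E).

Definition ip f g : R := \int[nu]_x (f x * g x).

(** [|f g| <= f^2 + g^2]. *)
Lemma sqint_ip f g : sqint f -> sqint g ->
  nu.-integrable [set: T] (fun x => (f x * g x)%:E).
Proof.
move=> [mf f2] [mg g2].
have := integrableD measurableT f2 g2.
apply: le_integrable => //; first by apply/measurable_EFinP; exact: measurable_funM.
move=> x _ /=; rewrite lee_fin [leRHS]ger0_norm ?addr_ge0 ?sqr_ge0//.
rewrite ler_norml; apply/andP; split.
  have : 0 <= (f x + g x) ^+ 2 + f x ^+ 2 + g x ^+ 2 by rewrite !addr_ge0 ?sqr_ge0.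
  by nra.
have : 0 <= (f x - g x) ^+ 2 + f x ^+ 2 + g x ^+ 2 by rewrite !addr_ge0 ?sqr_ge0.
by nra.
Qed.

Lemma sqintD f g : sqint f -> sqint g -> sqint (fun x => f x + g x).
Proof.
move=> [mf f2] [mg g2]; split; first exact: measurable_funD.
have := integrableD measurableT (integrableZl measurableT 2 f2) (integrableZl measurableT 2 g2).
apply: le_integrable => //.
  by apply/measurable_EFinP; apply: measurable_funX; exact: measurable_funD.
move=> x _ /=.
have h0 : 0 <= 2 * f x ^+ 2 + 2 * g x ^+ 2.
  by apply: addr_ge0; apply: mulr_ge0; rewrite ?sqr_ge0.
rewrite lee_fin [leRHS]ger0_norm// ger0_norm ?sqr_ge0//.
have : 0 <= (f x - g x) ^+ 2 by rewrite sqr_ge0.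
by nra.
Qed.

Lemma sqintZ c f : sqint f -> sqint (fun x => c * f x).
Proof.
move=> [mf f2]; split; first exact: measurable_funM.
have := integrableZl measurableT (c ^+ 2) f2.
by apply: eq_integrable => // x _; rewrite exprMn EFinM.
Qed.

Lemma sqintB f g : sqint f -> sqint g -> sqint (fun x => f x - g x).
Proof.
move=> sf sg; have := sqintD sf (sqintZ (-1) sg).
by under [X in sqint X -> _]eq_fun do rewrite mulN1r.
Qed.

Lemma sqint0 : sqint (fun=> 0).
Proof.
split; first exact: measurable_cst.
by under eq_fun do rewrite expr0n/=; exact: integrable0.
Qed.

Lemma ipC f g : ip f g = ip g f.
Proof. by apply: eq_Rintegral => x _; rewrite mulrC. Qed.

Lemma ipDl f g h : sqint f -> sqint g -> sqint h ->
  ip (fun x => f x + g x) h = ip f h + ip g h.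
Proof.
move=> sf sg sh; rewrite /ip -RintegralD//; [|exact: sqint_ip|exact: sqint_ip].
by apply: eq_Rintegral => x _; rewrite mulrDl.
Qed.

Lemma ipZl c f h : sqint f -> sqint h -> ip (fun x => c * f x) h = c * ip f h.
Proof.
move=> sf sh; rewrite /ip -RintegralZl//; last exact: sqint_ip.
by apply: eq_Rintegral => x _; rewrite mulrA.
Qed.

Lemma ipBl f g h : sqint f -> sqint g -> sqint h ->
  ip (fun x => f x - g x) h = ip f h - ip g h.
Proof.
move=> sf sg sh; rewrite /ip -RintegralB//; [|exact: sqint_ip|exact: sqint_ip].
by apply: eq_Rintegral => x _; rewrite mulrBl.
Qed.

Lemma ipBr f g h : sqint f -> sqint g -> sqint h ->
  ip f (fun x => g x - h x) = ip f g - ip f h.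
Proof. by move=> sf sg sh; rewrite ipC ipBl// !(ipC f). Qed.

Lemma sqint_sum (I : Type) (s : seq I) (c : I -> R) (F : I -> T -> R) :
  (forall i, sqint (F i)) -> sqint (fun x => \sum_(i <- s) c i * F i x).
Proof.
move=> sF; elim: s => [|i s IH].
  by under eq_fun do rewrite big_nil; exact: sqint0.
under eq_fun do rewrite big_cons; apply: sqintD => //; exact: sqintZ.
Qed.

Lemma ip_suml (I : Type) (s : seq I) (c : I -> R) (F : I -> T -> R) h :
  (forall i, sqint (F i)) -> sqint h ->
  ip (fun x => \sum_(i <- s) c i * F i x) h = \sum_(i <- s) c i * ip (F i) h.
Proof.
move=> sF sh; elim: s => [|i s IH].
  rewrite big_nil /ip; under eq_Rintegral do rewrite big_nil mul0r.
  by rewrite Rintegral_cst// mul0r.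
rewrite big_cons -IH -ipZl// -ipDl//; [|exact: sqintZ|exact: sqint_sum].
by congr ip; apply/funext => x; rewrite big_cons.
Qed.

Lemma Lfun2_sqint f : f \in Lfun nu 2%:E -> sqint f.
Proof.
move=> lf; split; last exact: Lfun2_integrable_sqr.
by move: lf; rewrite inE => /andP[]; rewrite inE.
Qed.

Lemma ip_le f g a b : sqint f -> sqint g ->
  ('N[nu]_2%:E[EFin \o f] = a%:E)%E -> ('N[nu]_2%:E[EFin \o g] = b%:E)%E ->
  `|ip f g| <= a * b.
Proof.
move=> sf sg fa gb; rewrite -lee_fin EFinM -fa -gb.
have h2 : (2^-1 + 2^-1 = 1 :> R) by rewrite [RHS]splitr !div1r.
apply: le_trans (hoelder _ sf.1 sg.1 _ _ h2) => //.
rewrite Lnorm1 (_ : `|ip f g|%:E = `|\int[nu]_x (f x * g x)%:E|%E).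
  apply: le_abse_integral => //.
  by apply/measurable_EFinP; apply: measurable_funM; [exact: sf.1|exact: sg.1].
rewrite /ip /Rintegral -[in RHS](fineK (integrable_fin_num measurableT (sqint_ip sf sg))).
by [].
Qed.

(** Expand [f g - f_n g_n] in the errors [f - f_n] and [g - g_n] and apply the
    inequality of Cauchy and Schwarz to each of the three terms. *)
Lemma ip_cvg f g (f_ g_ : nat -> T -> R) :
  f \in Lfun nu 2%:E -> g \in Lfun nu 2%:E ->
  (forall n, sqint (f_ n)) -> (forall n, sqint (g_ n)) ->
  ('N[nu]_2%:E[EFin \o (f \- f_ n)%R] @[n --> \oo] --> 0)%E ->
  ('N[nu]_2%:E[EFin \o (g \- g_ n)%R] @[n --> \oo] --> 0)%E ->
  ip (f_ n) (g_ n) @[n --> \oo] --> ip f g.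
Proof.
move=> lf lg sf_ sg_ Nf Ng.
have sf := Lfun2_sqint lf; have sg := Lfun2_sqint lg.
have Lfin h : h \in Lfun nu 2%:E -> ('N[nu]_2%:E[EFin \o h] = (fine 'N[nu]_2%:E[EFin \o h])%:E)%E.
  rewrite inE => /andP[_]; rewrite inE /= => hfin.
  by rewrite fineK// ge0_fin_numE ?Lnorm_ge0.
set A := fine 'N[nu]_2%:E[EFin \o f]; set B := fine 'N[nu]_2%:E[EFin \o g].
have /fine_cvgP[ffin fcvg] := Nf; have /fine_cvgP[gfin gcvg] := Ng.
pose a n := fine 'N[nu]_2%:E[EFin \o (f \- f_ n)%R].
pose b n := fine 'N[nu]_2%:E[EFin \o (g \- g_ n)%R].
have ab0 : A * b n + a n * B + a n * b n @[n --> \oo] --> (0 : R).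
  rewrite (_ : 0 = A * 0 + 0 * B + 0 * 0); last by rewrite !(mulr0, mul0r, addr0).
  apply: cvgD; [apply: cvgD; apply: cvgM|apply: cvgM] => //; exact: cvg_cst.
apply/cvgrPdist_le => e e0.
have /cvgrPdist_le/(_ e e0) := ab0.
apply: filter_app; near=> n.
rewrite sub0r normrN => abn; apply: le_trans abn.
apply: (@le_trans _ _ (A * b n + a n * B + a n * b n)); last exact: ler_norm.
have fn : ('N[nu]_2%:E[EFin \o (f \- f_ n)%R] = (a n)%:E)%E.
  by rewrite fineK//; near: n; exact: ffin.
have gn : ('N[nu]_2%:E[EFin \o (g \- g_ n)%R] = (b n)%:E)%E.
  by rewrite fineK//; near: n; exact: gfin.
have sfn := sqintB sf (sf_ n); have sgn := sqintB sg (sg_ n).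
have h1 := ip_le sf sgn (Lfin _ lf) gn.
have h2 := ip_le sfn sg fn (Lfin _ lg).
have h3 := ip_le sfn sgn fn gn.
have -> : ip f g - ip (f_ n) (g_ n) = ip f (g \- g_ n) + ip (f \- f_ n) g - ip (f \- f_ n) (g \- g_ n).
  have e1 := ipBr sf sg (sg_ n); have e2 := ipBl sf (sf_ n) sg.
  have e3 := ipBl sf (sf_ n) sgn; have e4 := ipBr (sf_ n) sg (sg_ n).
  by rewrite e3 e1 e2 e4; ring.
rewrite (le_trans (ler_normB _ _))// lerD// (le_trans (ler_normD _ _))// lerD//.
Unshelve. all: by end_near. Qed.

End square_integrable.

(** * The variance of the normal law *)

Section density.
Import HBNNSimple.
Local Open Scope ereal_scope.
Context d (T : measurableType d) {R : realType}.
Variables (mu nu : {measure set T -> \bar R}) (g : T -> R).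
Hypotheses (mg : measurable_fun [set: T] g) (g0 : forall x, (0 <= g x)%R).
Hypothesis nuE : forall A, measurable A -> nu A = \int[mu]_(x in A) (g x)%:E.

Let mgE : measurable_fun [set: T] (EFin \o g). Proof. exact/measurable_EFinP. Qed.

Let integral_density_nnsfun (h : {nnsfun T >-> R}) :
  \int[nu]_x (h x)%:E = \int[mu]_x ((h x)%:E * (g x)%:E).
Proof.
have mh k : measurable (h @^-1` [set k]) by [].
under eq_integral do rewrite fimfunE -fsumEFin//.
rewrite ge0_integral_fsum//; last 2 first.
- by move=> y; exact/measurable_EFinP/measurable_funM.
- by move=> y x _; rewrite nnfun_muleindic_ge0.
under [RHS]eq_integral => x _.
  rewrite fimfunE -fsumEFin// muleC ge0_mule_fsumr; last first.
    by move=> y; rewrite nnfun_muleindic_ge0.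
  over.
rewrite ge0_integral_fsum//; last 2 first.
- move=> y; apply: emeasurable_funM => //.
  by exact/measurable_EFinP/measurable_funM.
- move=> y x _; apply: mule_ge0; first by rewrite lee_fin.
  by rewrite nnfun_muleindic_ge0.
apply: eq_fsbigr => k _.
rewrite integralZl_indic_nnsfun// integral_indic//= setIT nuE//.
have [k0|k0] := leP 0%R k; last first.
  rewrite (preimage_nnfun0 _ k0) integral_set0 mule0.
  by rewrite integral0_eq// => x _; rewrite indic0 mulr0 mule0.
rewrite -ge0_integralZl_EFin//; last 2 first.
- by move=> x _; rewrite lee_fin.
- exact: measurable_funTS.
rewrite integral_mkcond; apply: eq_integral => x _.
rewrite patchE indicE; case: ifPn => _ /=; last by rewrite mulr0 mule0.
by rewrite mulr1 muleC.
Qed.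

(** Both sides are continuous along increasing sequences, which reduces the
    identity to nonnegative simple functions. *)
Lemma ge0_integral_density (f : T -> \bar R) :
  measurable_fun [set: T] f -> (forall x, 0 <= f x) ->
  \int[nu]_x f x = \int[mu]_x (f x * (g x)%:E).
Proof.
move=> mf f0; pose f_ := nnsfun_approx measurableT mf.
have fcvg x : (f_ n x)%:E @[n --> \oo] --> f x by apply: cvg_nnsfun_approx.
transitivity (limn (fun n => \int[nu]_x (f_ n x)%:E)).
  rewrite -monotone_convergence//.
  - by apply: eq_integral => x _; apply/esym/cvg_lim.
  - by move=> n; exact/measurable_EFinP.
  - by move=> n x _; rewrite lee_fin.
  - by move=> x _ m n mn; rewrite lee_fin; exact/lefP/nd_nnsfun_approx.
under eq_fun do rewrite integral_density_nnsfun.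
rewrite -monotone_convergence//.
- apply: eq_integral => x _; apply/cvg_lim => //.
  by apply: cvgeMr.
- by move=> n; apply: emeasurable_funM => //; exact/measurable_EFinP.
- by move=> n x _; rewrite mule_ge0// lee_fin.
- move=> x _ m n mn; apply: lee_wpmul2r; first by rewrite lee_fin.
  by rewrite lee_fin; exact/lefP/nd_nnsfun_approx.
Qed.

End density.

Section normal_variance.
Context {R : realType}.
Local Notation mu := (@lebesgue_measure R).

(** Integration by parts: [(x^2 - s^2)] times the density [p] is the
    derivative of [- s^2 x p], which vanishes at both infinities. *)
Lemma integral_sqr_normal_pdf (s : R) : 0 < s ->
  (\int[mu]_x (x ^+ 2 * normal_pdf 0 s x)%:E = (s ^+ 2)%:E)%E.
Proof.
move=> s0; have sn : s != 0 by rewrite gt_eqF.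
have s2 : s ^+ 2 != 0 by rewrite expf_neq0.
pose p x : R := normal_pdf 0 s x.
have pE x : p x = normal_peak s * expR (- (x ^+ 2) / (s ^+ 2 *+ 2)).
  by rewrite /p normal_pdfE// /normal_fun subr0.
have dp (x : R) : is_derive x 1 p (- (x / s ^+ 2) * p x).
  rewrite (_ : p = (fun x => normal_peak s * expR (- (x ^+ 2) / (s ^+ 2 *+ 2)))); last exact/funext.
  apply: is_derive_eq; rewrite /GRing.scale/= mulr2n; field.
  by rewrite sn -mulr2n mulrn_eq0 negb_or s2.
have p0 x : 0 <= p x by exact: normal_pdf_ge0.
have cp : continuous p by apply: derivable_continuousT => x; have := dp x => h; exact: ex_derive.
have := @ge0_integral_FTC R (fun x => x ^+ 2 * p x) (fun x => s ^+ 2 * p x)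
  (fun x => - (s ^+ 2) * (x * p x)) 0 0.
have lim0 : x * p x @[x --> +oo] --> (0 : R).
  have s20 : 0 < 2 * s ^+ 2 by rewrite mulr_gt0// exprn_gt0.
  (* Chosen so that [expR z >= 1 + z] bounds the density by a rational function. *)
  pose q : R := Num.sqrt (2 * s ^+ 2).
  have q0 : 0 < q by rewrite sqrtr_gt0.
  have q2 : q ^+ 2 = 2 * s ^+ 2 by rewrite sqr_sqrtr// ltW.
  have h : normal_peak s * q ^+ 2 * (x / (q ^+ 2 + x ^+ 2)) @[x --> +oo] --> (0 : R).
    rewrite -[X in _ --> X](mulr0 (normal_peak s * q ^+ 2)).
    by apply: cvgM; [exact: cvg_cst|exact: cvgy_xsqrD].
  apply: (squeeze_cvgr _ (cvg_cst 0) h); near=> x.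
  have x0 : 0 < x by near: x; apply: nbhs_pinfty_gt; exact: num_real.
  rewrite mulr_ge0 ?p0 ?(ltW x0)//= pE.
  have qx := gt0_sqrD x q0.
  rewrite (_ : normal_peak s * q ^+ 2 * (x / (q ^+ 2 + x ^+ 2)) =
     x * (normal_peak s * (q ^+ 2 / (q ^+ 2 + x ^+ 2)))); last by field; rewrite gt_eqF.
  rewrite ler_wpM2l ?(ltW x0)// ler_wpM2l ?normal_peak_ge0//.
  rewrite mulNr expRN -[q ^+ 2 / _]invf_div lef_pV2 ?posrE ?expR_gt0 ?divr_gt0 ?exprn_gt0//.
  apply: le_trans (expR_ge1Dx _).
  rewrite mulrDl mulfV ?gt_eqF ?exprn_gt0// lerD2l q2 -[s ^+ 2 *+ 2]mulr_natl.
  by [].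
have lim1 : x * p x @[x --> -oo] --> (0 : R).
  apply/cvgNy_compNP; rewrite [X in X x @[x --> +oo] --> _](_ : _ = (fun x => - (x * p x))).
    have h := cvgN lim0; rewrite oppr0 in h; exact: h.
  by apply/funext => x /=; rewrite !pE sqrrN mulNr.
move=> H; have {H} : (\int[mu]_x (x ^+ 2 * p x)%:E + 0%:E = \int[mu]_x (s ^+ 2 * p x)%:E + 0%:E)%E.
  apply: H.
  - by move=> x; apply: cvgM; [exact: exprn_continuous|exact: cp].
  - by move=> x; apply: cvgM; [exact: cvg_cst|exact: cp].
  - by move=> x; rewrite mulr_ge0 ?sqr_ge0.
  - by move=> x; rewrite mulr_ge0 ?sqr_ge0.
  - move=> x; have := dp x => h; apply: is_derive_eq; rewrite /GRing.scale/=.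
    by field.
  - have := cvgM (cvg_cst (- s ^+ 2)) lim0; rewrite mulr0; exact.
  - have := cvgM (cvg_cst (- s ^+ 2)) lim1; rewrite mulr0; exact.
rewrite !adde0 => ->; rewrite integralZlr ?sqr_ge0//.
  by rewrite /p integral_normal_pdf mule1.
exact: measurable_normal_pdf.
Unshelve. all: by end_near. Qed.

End normal_variance.

(** * The Wiener isometry *)

(** The length of the intersection of two intervals, in the form that
    polarization gives to the covariance of two increments. *)
Lemma itv_overlap (R : realType) (a b c e : R) : a <= b -> c <= e ->
  (if Num.max a c < Num.min b e then Num.min b e - Num.max a c else 0) =
  (`|b - c| + `|a - e| - `|a - c| - `|b - e|) / 2.
Proof.
move=> ab ce.
have abs (u v : R) : u <= v -> `|u - v| = v - u by move=> uv; rewrite distrC ger0_norm ?subr_ge0.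
have abs' (u v : R) : v <= u -> `|u - v| = u - v by move=> uv; rewrite ger0_norm ?subr_ge0.
have [bc|cb] := leP b c.
  rewrite (abs _ _ bc) (abs a e) ?(abs a c) ?(abs b e); try by lra.
  case: ifP => [|_]; last by lra.
  by rewrite gt_max !lt_min => /andP[_ /andP[h _]]; lra.
have [ea|ae] := leP e a.
  rewrite (abs' b c) ?(abs' a e) ?(abs' a c) ?(abs' b e); try by lra.
  case: ifP => [|_]; last by lra.
  by rewrite gt_max !lt_min => /andP[/andP[_ h] _]; lra.
rewrite (abs' b c) ?(abs a e); try by lra.
have -> : `|a - c| = 2 * Num.max a c - a - c.
  by case: (leP a c) => h; [rewrite abs//|rewrite abs' ?ltW//]; ring.
have -> : `|b - e| = b + e - 2 * Num.min b e.
  by case: (leP b e) => h; [rewrite abs//|rewrite abs' ?ltW//]; ring.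
case: ifPn => [_|]; first by field.
rewrite gt_max !lt_min cb ae /= andbT => /nandP[|]; rewrite -leNgt => h.
  have {ab}e1 : a = b by apply/le_anti; rewrite ab h.
  by rewrite e1 max_l ?min_l -?e1 ?ltW//; lra.
have {ce}e1 : c = e by apply/le_anti; rewrite ce h.
by rewrite e1 max_r ?min_r -?e1 ?ltW//; lra.
Qed.

Section wiener_isometry.
Context (d : measure_display) (T : measurableType d) {R : realType}
  (P : probability T R) (W : R -> {RV P >-> R}).
Hypothesis hW : brownian_motion W.
Local Notation mu := (@lebesgue_measure R).
Local Notation inc := (increment W).

Lemma measurable_increment (s t : R) : measurable_fun [set: T] (inc s t).
Proof. exact: measurable_funB. Qed.

(** Transported to the line by the law of the increment, this is the variance
    of the normal law. *)
Lemma integral_sqr_increment (s t : R) :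
  (\int[P]_w (inc s t w ^+ 2)%:E = `|t - s|%:E)%E.
Proof.
have lt (u v : R) : u < v -> (\int[P]_w (inc u v w ^+ 2)%:E = `|v - u|%:E)%E.
  move=> uv; have vu0 : 0 < v - u by rewrite subr_gt0.
  have mX := measurable_increment u v.
  have msq : measurable_fun [set: R] (fun x : R => (x ^+ 2)%:E) by meas.
  have sq0 (x : R) : (0 <= (x ^+ 2)%:E :> \bar R)%E by rewrite lee_fin sqr_ge0.
  have := @ge0_integral_pushforward _ _ T (measurableTypeR R) R (inc u v) mX P setT
    (fun x => (x ^+ 2)%:E) measurableT msq (fun x _ => sq0 x).
  rewrite preimage_setT => <-.
  rewrite (eq_measure_integral (normal_prob 0 (Num.sqrt (v - u)))); last first.
    by move=> A mA _; exact: (bm_increment hW uv).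
  rewrite (ge0_integral_density (mu := mu) (g := normal_pdf 0 (Num.sqrt (v - u))))//.
  - have s0 : 0 < Num.sqrt (v - u) by rewrite sqrtr_gt0.
    by rewrite (integral_sqr_normal_pdf s0) sqr_sqrtr ?ltW// gtr0_norm.
  - exact: measurable_normal_pdf.
  - by move=> x; exact: normal_pdf_ge0.
have [st|ts|->] := ltgtP s t; first exact: lt.
  rewrite distrC -(lt _ _ ts); apply: eq_integral => w _; congr EFin.
  by rewrite /increment/= -sqrrN opprB.
rewrite subrr normr0 integral0_eq// => w _.
by rewrite /increment/= subrr expr0n.
Qed.

Lemma sqint_increment (s t : R) : sqint P (inc s t).
Proof.
split; first exact: measurable_increment.
apply/integrableP; split.
  by apply/measurable_EFinP; apply: measurable_funX; exact: measurable_increment.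
under eq_integral do rewrite /= ger0_norm ?sqr_ge0//.
by rewrite integral_sqr_increment ltry.
Qed.

Lemma ip_increment_sqr (s t : R) : ip P (inc s t) (inc s t) = `|t - s|.
Proof.
rewrite /ip /Rintegral; under eq_integral do rewrite -expr2.
by rewrite integral_sqr_increment.
Qed.

Lemma ip_increment0 (a b c : R) :
  ip P (inc a b) (inc a c) = (`|b - a| + `|c - a| - `|b - c|) / 2.
Proof.
have sb := sqint_increment a b; have sc := sqint_increment a c.
have := ip_increment_sqr c b.
rewrite (_ : inc c b = (fun w => inc a b w - inc a c w)); last first.
  by apply/funext => w; rewrite /increment/=; ring.
rewrite (ipBl sb sc (sqintB sb sc)) (ipBr sb sb sc) (ipBr sc sb sc).
rewrite (ip_increment_sqr a b) (ip_increment_sqr a c) (ipC P (inc a c)) => <-.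
by field.
Qed.

(** Polarization: the second moments of all increments determine all the
    covariances, since a difference of increments with a common origin is an
    increment. *)
Lemma ip_increment (a b c e : R) : ip P (inc a b) (inc c e) =
  (`|b - c| + `|a - e| - `|a - c| - `|b - e|) / 2.
Proof.
rewrite (_ : inc c e = (fun w => inc a e w - inc a c w)); last first.
  by apply/funext => w; rewrite /increment/=; ring.
rewrite (ipBr (sqint_increment a b) (sqint_increment a e) (sqint_increment a c)).
by rewrite !ip_increment0 (distrC e) (distrC c); field.
Qed.

Lemma sqint_indic_itv (a b : R) : sqint mu (\1_`]a, b] : R -> R).
Proof.
split; first exact: measurable_indic.
apply/integrableP; split.
  by apply/measurable_EFinP; apply: measurable_funX; exact: measurable_indic.
under eq_integral => x _.
  rewrite (_ : `|(\1_`]a, b] x ^+ 2)%:E|%E = (\1_`]a, b] x : R)%:E); last first.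
    by rewrite /= indicE; case: (_ \in _); rewrite ?expr1n ?expr0n ?normr1 ?normr0.
  over.
rewrite integral_indic//= setIT lebesgue_measure_itv/=.
by case: ifP => _; rewrite ?ltry// -EFinD ltry.
Qed.

Lemma ip_indic_itv (a b c e : R) : a <= b -> c <= e ->
  ip mu (\1_`]a, b] : R -> R) (\1_`]c, e] : R -> R) =
  (`|b - c| + `|a - e| - `|a - c| - `|b - e|) / 2.
Proof.
move=> ab ce; rewrite /ip /Rintegral.
under eq_integral => x _.
  rewrite (_ : _ * _ = \1_`](Num.max a c), (Num.min b e)] x :> R); last first.
    rewrite !indicE -natrM mulnb; congr (nat_of_bool _)%:R.
    have mi (u v : R) : (x \in (`]u, v]%classic : set R)) = (u < x <= v).
      by apply/idP/idP; rewrite inE/= in_itv.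
    by rewrite !mi gt_max le_min andbACA.
  over.
rewrite integral_indic//= setIT lebesgue_measure_itv/= lte_fin.
by rewrite -itv_overlap//; case: ifP.
Qed.

Lemma sqint_step_wiener p : sqint P (step_wiener W p).
Proof. by apply: sqint_sum => u; exact: sqint_increment. Qed.

Lemma sqint_step_fun (p : seq (R * R * R)) : sqint mu (step_fun p).
Proof. by apply: sqint_sum => u; exact: sqint_indic_itv. Qed.

Lemma ip_step p q : step_ok p -> step_ok q ->
  ip P (step_wiener W p) (step_wiener W q) = ip mu (step_fun p) (step_fun q).
Proof.
move=> /allP okp /allP okq.
rewrite (ip_suml _ _ (fun u => sqint_increment u.1.2 u.2) (sqint_step_wiener q)).
rewrite (ip_suml _ _ (fun u : R * R * R => sqint_indic_itv u.1.2 u.2) (sqint_step_fun q)).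
apply: eq_big_seq => u /okp uok; congr (_ * _); rewrite ipC [RHS]ipC.
rewrite (ip_suml _ _ (fun u => sqint_increment u.1.2 u.2) (sqint_increment _ _)).
rewrite (ip_suml _ _ (fun u : R * R * R => sqint_indic_itv u.1.2 u.2) (sqint_indic_itv _ _)).
apply: eq_big_seq => v /okq vok; congr (_ * _).
by rewrite ip_increment ip_indic_itv.
Qed.

Lemma wiener_isometry (f g : R -> R) (I J : {RV P >-> R}) :
  is_wiener_integral W f I -> is_wiener_integral W g J ->
  ip P I J = ip mu f g.
Proof.
move=> [lf lI [p [okp fp Ip]]] [lg lJ [q [okq gq Jq]]].
have h1 := ip_cvg lI lJ (fun n => sqint_step_wiener (p n)) (fun n => sqint_step_wiener (q n)) Ip Jq.
have h2 := ip_cvg lf lg (fun n => sqint_step_fun (p n)) (fun n => sqint_step_fun (q n)) fp gq.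
have h3 : ip P (step_wiener W (p n)) (step_wiener W (q n)) @[n --> \oo] --> ip mu f g.
  by under eq_fun do rewrite ip_step//; exact: h2.
exact: (cvg_unique _ h1 h3).
Qed.

End wiener_isometry.

(** * The normalizing constants and the covariance of the field *)

Section constants.
Context {R : realType}.
Local Notation mu := (@lebesgue_measure R).

Lemma Gamma_gt0 (s : R) : 0 < s -> 0 < Gamma s.
Proof.
by move=> s0; rewrite Gamma_egamma fine_gt0// egamma_gt0 (egamma_fin s0) ltry.
Qed.

Lemma Gamma1 : Gamma 1 = 1 :> R.
Proof. by rewrite Gamma_egamma egamma1. Qed.

(** The integrand is the derivative of [- 1 / (1 + u)]. *)
Lemma ebeta11 : ebeta 1 1 = 1%E :> \bar R.
Proof.
have := @ge0_integral_FTC R (fun x => expR (1 * x - (1 + 1) * ln (1 + expR x))) (cst 0)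
  (fun x => - (1 + expR x)^-1) 0 (- 1).
under [X in (_ = X + _)%E]eq_integral do rewrite /=.
rewrite integral0 => h.
have eE (x : R) : expR (1 * x - (1 + 1) * ln (1 + expR x)) = expR x / (1 + expR x) ^+ 2.
  by rewrite mul1r expRB expR2 lnK// posrE gt0_1pexpR.
have : (ebeta 1 1 + (- 1)%:E = 0 + 0%:E :> \bar R)%E.
  apply: h.
  - rewrite (_ : (fun x => _) = (fun x : R => expR x / (1 + expR x) ^+ 2)); last exact/funext.
    move=> x; apply: cvgM; first exact: continuous_expR.
    apply: cvgV; first by rewrite gt_eqF// exprn_gt0// gt0_1pexpR.
    by apply: (derivable_continuousT (f := fun x => (1 + expR x) ^+ 2)) => y; exact: ex_derive.
  - by move=> x; exact: cvg_cst.
  - by move=> x; exact: expR_ge0.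
  - by [].
  - move=> x; have n0 : 1 + expR x != 0 by rewrite gt_eqF// gt0_1pexpR.
    have h2 : is_derive x 1 (fun x : R => (1 + expR x)^-1) (- (1 + expR x)^-2 * expR x).
      by apply: (@is_derive_eq _ _ _ _ _ _ _ _ (is_deriveV _ _)); rewrite // /GRing.scale/=; ring.
    by apply: is_derive_eq; rewrite eE subr0 mulNr opprK mulrC.
  - rewrite -[X in _ --> X]oppr0; apply: cvgN.
    apply: (cvg_comp (fun x : R => 1 + expR x) (@GRing.inv R)); last exact: cvgy_inv.
    rewrite (_ : (fun x : R => 1 + expR x) = (fun r => r + 1) \o expR); last first.
      by apply/funext => x /=; rewrite addrC.
    by apply: cvg_comp; [exact: cvgy_expR|exact: cvg_addrr].
  - have h1 : (1 + expR x)^-1 @[x --> -oo] --> ((1 + 0)^-1 : R).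
      apply: cvgV; first by rewrite addr0 oner_neq0.
      apply: cvgD; first exact: cvg_cst.
      by have := @cvgNy_expRM R 1 ltr01; under eq_fun do rewrite mul1r.
    by rewrite addr0 invr1 in h1; apply: cvgN; exact: h1.
have : (0 <= ebeta 1 1 :> \bar R)%E by apply: integral_ge0 => x _; rewrite lee_fin expR_ge0.
case: (ebeta 1 1) => //= r _.
by rewrite adde0 -EFinD => -[h1]; congr EFin; lra.
Qed.

(** Read off from [B(1, 1) = Gamma(1)^2 / Gamma(2)]. *)
Lemma Gamma2 : Gamma 2 = 1 :> R.
Proof.
have := @ebeta_fine R 1 1 ltr01 ltr01; rewrite ebeta11 -!Gamma_egamma Gamma1 mul1r.
rewrite (_ : 1 + 1 = 2)// => -[h].
by move: h; rewrite div1r => h; apply: invr_inj; rewrite -h invr1.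
Qed.

(** One formula for both branches: [k_H] is the constant of the representation
    by Poisson kernels, times [pi] and the Gamma factor that [ebeta_fine]
    contributes to the covariance. *)
Lemma kconstE (H : R) :
  kconst H = pi * Gamma (H - 2^-1 + 1) * riesz_cst (H - 2^-1).
Proof.
rewrite /kconst /riesz_cst subr_eq0; case: eqP => [->|_].
  by rewrite subrr add0r Gamma1 !mulr1.
rewrite (_ : H - 2^-1 + 1 = H + 2^-1); last by field.
rewrite (_ : pi * (H - 2^-1) / 2 = (H - 2^-1) * (pi / 2)); last by field.
have pn : (pi : R) != 0 by rewrite gt_eqF// pi_gt0.
by move: (pi : R) pn => c c0; field; rewrite c0.
Qed.

(** Both squares contain the same power of a sine, as
    [1 - sin (pi m) = 2 sin^2 ((m - 1/2) pi/2)].  At [m = 1/2] the quotient is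
    1 by convention, in agreement with the formula because [Gamma 2 = 1]. *)
Lemma dconst_kconst (m : R) : 0 < m < 1 ->
  dconst m ^+ 2 / kconst m ^+ 2 = (Gamma (2 * m + 1) * sin (pi * m))^-1.
Proof.
move=> m01; have pi0 := @pi_gt0 R.
rewrite /dconst /kconst; case: eqP => [->|/eqP m2].
  by rewrite mulfV ?expf_neq0 ?gt_eqF// divff// (_ : 1 + 1 = 2)// Gamma2 sin_pihalf mulr1 invr1.
have G0 : 0 < Gamma (m + 2^-1) by apply: Gamma_gt0; lra.
have G2 : 0 < Gamma (2 * m + 1) by apply: Gamma_gt0; lra.
have s0 : 0 < sin (pi * m).
  by apply: sin_gt0_pi; apply/andP; split; [rewrite mulr_gt0//; lra|rewrite gtr_pMr//; lra].
have k0 : sin ((m - 2^-1) * (pi / 2)) != 0.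
  rewrite (_ : (m - 2^-1) * (pi / 2) = pi * (m - 2^-1) / 2); last by field.
  by apply: sin_half_neq0; [lra|rewrite subr_eq0].
have hs : 1 - sin (pi * m) = 2 * sin ((m - 2^-1) * (pi / 2)) ^+ 2.
  rewrite (_ : pi * m = ((m - 2^-1) * (pi / 2)) *+ 2 + pi / 2); last by rewrite mulr2n; field.
  by rewrite sinDpihalf cos_mulr2n cos2sin2 mulr2n; ring.
rewrite !exprMn exprVn !sqr_sqrtr; last 2 first.
- by rewrite mulr_ge0// divr_ge0 ?(ltW s0)// subr_ge0 sin_le1.
- exact: ltW.
rewrite hs; move: (sin (pi * m)) (sin _) s0 k0 (Gamma _) (Gamma _) G0 G2.
by move=> u v u0 v0 g1 g2 g10 g20; field; rewrite v0 !gt_eqF.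
Qed.

End constants.

Section covariance.
Context {R : realType}.
Local Notation mu := (@lebesgue_measure R).

Lemma measurable_fbm_kernel (H t : R) : measurable_fun [set: R] (fbm_kernel H t).
Proof. by rewrite /fbm_kernel; case: eqP => _; meas. Qed.

(** The kernels agree with the increments of [riesz] off the points [0, t, s],
    and finiteness of the integral of their product, which the Fubini
    argument needs, comes from square integrability. *)
Lemma ip_fbm_kernel (H H' t s : R) : 0 < H < 1 -> 0 < H' < 1 ->
  sqint mu (fbm_kernel H t) -> sqint mu (fbm_kernel H' s) ->
  ip mu (fbm_kernel H t) (fbm_kernel H' s) =
  kconst H * kconst H' / (Gamma (H + H' + 1) * sin (pi * ((H + H') / 2))) *
    ((`|t| `^ (H + H') + `|s| `^ (H + H') - `|t - s| `^ (H + H')) / 2).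
Proof.
move=> H01 H'01 sK sK'.
pose a := H - 2^-1; pose b := H' - 2^-1.
have a1 : -1 < a < 1 by rewrite /a; lra.
have b1 : -1 < b < 1 by rewrite /b; lra.
have ab : -1 < a + b < 1 by rewrite /a /b; lra.
pose ka x := riesz a `|t - x| - riesz a `|x|.
pose kb x := riesz b `|s - x| - riesz b `|x|.
have mr c u : measurable_fun [set: R] (fun x : R => riesz c `|u - x|).
  by rewrite /riesz; case: (c == 0); meas.
have mr0 c : measurable_fun [set: R] (fun x : R => riesz c `|x|).
  by rewrite /riesz; case: (c == 0); meas.
have mka : measurable_fun [set: R] ka by exact: measurable_funB.
have mkb : measurable_fun [set: R] kb by exact: measurable_funB.
have mK := measurable_fbm_kernel H t; have mK' := measurable_fbm_kernel H' s.
pose N : set R := [set 0; t; s]%classic.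
have cN : countable N by apply: finite_set_countable; rewrite /N; exact: finite_set3.
have KE x : ~ N x -> fbm_kernel H t x * fbm_kernel H' s x = ka x * kb x.
  move=> Nx.
  have x0 : x != 0 by apply/eqP => e; apply: Nx; left; left.
  have tx0 : t - x != 0 by rewrite subr_eq0; apply/eqP => e; apply: Nx; left; right.
  have sx0 : s - x != 0 by rewrite subr_eq0; apply/eqP => e; apply: Nx; right.
  by rewrite !fbm_kernelE.
have fin : (\int[mu]_x `|ka x * kb x|%:E < +oo)%E.
  have /integrableP[_] := sqint_ip sK sK'.
  apply: le_lt_trans; rewrite le_eqVlt; apply/orP; left; apply/eqP.
  apply: (eq_integral_countable cN).
  - by apply/measurable_EFinP; apply: measurableT_comp => //; exact: measurable_funM.
  - by do 2 apply: measurableT_comp => //; exact: measurable_funM.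
  - by move=> x Nx; rewrite KE.
have cE := integral_dlayer_prod a1 b1 ab fin.
have ca := riesz_cst_neq0 a1; have cb := riesz_cst_neq0 b1.
have mkk : measurable_fun [set: R] (fun x => ka x / riesz_cst a * (kb x / riesz_cst b)).
  by apply: measurable_funM; exact: measurable_funM.
have ikk : mu.-integrable setT (fun x => (ka x / riesz_cst a * (kb x / riesz_cst b))%:E).
  apply/integrableP; split; first exact/measurable_EFinP.
  have e x : `|ka x / riesz_cst a * (kb x / riesz_cst b)| =
      `|(riesz_cst a * riesz_cst b)^-1| * `|ka x * kb x|.
    by rewrite -normrM invfM; congr `|_|; ring.
  under eq_integral do rewrite /= e.
  rewrite integralZlr//; first by apply: lte_mul_pinfty => //; rewrite lee_fin.
  by apply: measurableT_comp => //; exact: measurable_funM.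
rewrite /ip /Rintegral.
have -> : (\int[mu]_x (fbm_kernel H t x * fbm_kernel H' s x)%:E =
    (riesz_cst a * riesz_cst b)%:E * \int[mu]_x (ka x / riesz_cst a * (kb x / riesz_cst b))%:E)%E.
  rewrite -integralZl//; apply: (eq_integral_countable cN).
  - by apply/measurable_EFinP; exact: measurable_funM.
  - by apply: measurable_funeM; exact/measurable_EFinP.
  - move=> x Nx; rewrite KE// -EFinM; congr EFin.
    by move: ca cb => ca cb; field; rewrite ca cb.
rewrite cE -EFinM /= /cov_cst !kconstE -/a -/b.
rewrite (_ : a + b + 1 = H + H'); last by rewrite /a /b; field.
rewrite (_ : a + b + 2 = H + H' + 1); last by rewrite /a /b; field.
rewrite (_ : pi * ((H + H') / 2) = pi * (H + H') / 2); last by rewrite mulrA.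
have G0 : Gamma (H + H' + 1) != 0 by rewrite gt_eqF// Gamma_gt0//; lra.
have s0 : sin (pi * (H + H') / 2) != 0.
  have pi0 := @pi_gt0 R; rewrite gt_eqF//; apply: sin_gt0_pi; apply/andP; split; nra.
move: (sin _) (Gamma (H + H' + 1)) (Gamma _) (Gamma _) s0 G0.
move: (_ `^ _) (_ `^ _) (_ `^ _) (riesz_cst a) (riesz_cst b) ca cb (pi : R).
move=> A B C u v u0 v0 p S g g1 g2 S0 g0.
by field; rewrite S0 g0.
Qed.

End covariance.

Theorem proposition11 (d : measure_display) (T : measurableType d)
    (R : realType) (P : probability T R)
    (W : R -> {RV P >-> R}) (WH : R -> R -> {RV P >-> R})
    (hW : brownian_motion W) (hWH : is_fbm_field W WH)
    (s t H H' : R) (hH : 0 < H < 1) (hH' : 0 < H' < 1) :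
  ('E_P[fun w => (WH H t w * WH H' s w)%R])%E =
    ((kconst H * kconst H') / (dconst H * dconst H') *
     (dconst ((H + H') / 2) ^+ 2 / kconst ((H + H') / 2) ^+ 2) *
     ((`|t| `^ (H + H') + `|s| `^ (H + H') - `|t - s| `^ (H + H')) / 2))%:E.
Proof.
have [I wI IE] := hWH H t hH; have [J wJ JE] := hWH H' s hH'.
have [lf lI _] := wI; have [lg lJ _] := wJ.
have sf := Lfun2_sqint lf; have sg := Lfun2_sqint lg.
have iIJ := sqint_ip (Lfun2_sqint lI) (Lfun2_sqint lJ).
rewrite unlock.
under eq_integral do rewrite IE JE mulrACA EFinM.
rewrite integralZl//.
have <- : (ip P I J)%:E = (\int[P]_w (I w * J w)%:E)%E.
  by rewrite /ip /Rintegral fineK//; exact: integrable_fin_num.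
rewrite -EFinM; congr EFin.
rewrite (wiener_isometry hW wI wJ) (ip_fbm_kernel hH hH' sf sg).
rewrite dconst_kconst; last lra.
rewrite (_ : 2 * ((H + H') / 2) + 1 = H + H' + 1); last by field.
rewrite !div1r -invfM; ring.
Qed.
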